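(* Let $(P,Q)$ be an irreducible pair of real quadratic forms on $\mathbb{R}^3$. Then: (1) $(P,Q)$ satisfies the (CM) condition if and only if it satisfies both the (D) condition and the $(\mathrm{R}_2)$ condition. (2) If $(P,Q)$ fails the (D) condition, then it is equivalent to $(\xi_1^2+\xi_2^2,\ \xi_3^2)$, or to $(\xi_1^2-\xi_2^2,\ \xi_3^2)$, or to $(\xi_1\xi_2+\xi_3^2,\ \xi_1^2)$. (3) If $(P,Q)$ satisfies the (D) condition and the $(\mathrm{R}_1)$ condition, then it is equivalent to $(\xi_1\xi_2,\ \xi_1\xi_3+\xi_2^2)$, or to $(\xi_1\xi_2,\ \xi_1^2+\xi_3^2)$, or to $(\xi_1\xi_2,\ \xi_1^2-\xi_3^2)$. (4) If $(P,Q)$ satisfies the (D) condition and the $(\mathrm{R}_0)$ condition, then it is equivalent to $(\xi_1\xi_2,\ \xi_1\xi_3)$.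
   Context: All quadratic forms are real quadratic forms in $\xi=(\xi_1,\xi_2,\xi_3)\in\mathbb{R}^3$. Irreducible: $(P,Q)$ is irreducible if $P$ and $Q$ are linearly independent and there does not exist an (invertible) linear change of coordinates in $\xi$ after which both $P(\xi)$ and $Q(\xi)$ omit a common variable. Equivalent: $(P,Q)$ and $(P',Q')$ are equivalent if there exist invertible real matrices $M_1\in M_{3\times3}$ and $M_2\in M_{2\times 2}$ such that $(P'(\xi),Q'(\xi))^T=M_2\cdot(P(M_1\xi),Q(M_1\xi))^T$ for every $\xi\in\mathbb{R}^3$. (CM) condition: writing $H_P,H_Q$ for the Hessian matrices of $P$ and $Q$, $$\int_{S^1}|\det(x_1H_P+x_2H_Q)|^{-\gamma}\,d\sigma(x_1,x_2)<\infty\quad\text{for every }0<\gamma<2/3,$$ where $S^1\subset\mathbb{R}^2$ is the unit circle and $d\sigma$ is its arc-length measure. (D) condition: for every nonzero vector $w\in\mathbb{R}^3$, the polynomial $\xi\mapsto\det[\nabla P(\xi),\nabla Q(\xi),w]$ is not identically zero. $(\mathrm{R}_{d'})$ condition, for $d'\in\{0,1,2\}$: $$\min_{H}\ \max_{\lambda_1,\lambda_2\in\mathbb{R}}\ \mathrm{rank}\big((\lambda_1P+\lambda_2Q)|_H\big)=d',$$ where the minimum is over hyperplanes $H\subset\mathbb{R}^3$ through the origin (two-dimensional linear subspaces), and the rank is that of the quadratic form restricted to $H$. *)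

(* Defs.v *)
From HB Require Import structures.
From mathcomp Require Export all_boot all_order all_algebra.
From mathcomp Require Export all_classical all_reals all_analysis.
Export Order.TTheory GRing.Theory Num.Theory.
Export numFieldNormedType.Exports.

Set Implicit Arguments.
Unset Strict Implicit.
Unset Printing Implicit Defensive.

Global Open Scope classical_set_scope.
Global Open Scope ring_scope.

Section QuadraticForms.
Context {R : realType}.
Implicit Types (P Q F : 'cV[R]_3 -> R) (x y : 'cV[R]_3).

Definition quadratic_form F : Prop :=
  exists A : 'M[R]_3, forall x, F x = (x^T *m A *m x) 0 0.

Definition xi1 x : R := x 0 0.
Definition xi2 x : R := x 1 0.
Definition xi3 x : R := x 2 0.

Definition lin_indep P Q : Prop :=
  forall a b : R, (forall x, a * P x + b * Q x = 0) -> a = 0 /\ b = 0.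

Definition omits_variable F (i : 'I_3) : Prop :=
  forall x y, (forall j, j != i -> x j 0 = y j 0) -> F x = F y.

Definition irreducible_pair P Q : Prop :=
  lin_indep P Q /\
  ~ exists M : 'M[R]_3, M \in unitmx /\
      exists i : 'I_3, omits_variable (fun x => P (M *m x)) i /\
                       omits_variable (fun x => Q (M *m x)) i.

Definition vec2 (a b : R) : 'cV[R]_2 := \col_k (if k == 0 then a else b).

Definition equivalent_pair P Q P' Q' : Prop :=
  exists (M1 : 'M[R]_3) (M2 : 'M[R]_2),
    [/\ M1 \in unitmx, M2 \in unitmx &
        forall x, vec2 (P' x) (Q' x) = M2 *m vec2 (P (M1 *m x)) (Q (M1 *m x))].

Definition basis_vec (i : 'I_3) : 'cV[R]_3 := delta_mx i 0.

Definition grad F x : 'cV[R]_3 := \col_i 'D_(basis_vec i) F x.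

Definition hessian F x : 'M[R]_3 :=
  \matrix_(i, j) 'D_(basis_vec i) ('D_(basis_vec j) F) x.

Definition unit_circle : set (R * R) := [set x | x.1 ^+ 2 + x.2 ^+ 2 = 1].

(* Image of Lebesgue measure on [0, 2 pi[ under the unit speed
   parametrization of the circle. *)
Definition arc_length : set (R * R) -> \bar R :=
  pushforward (mrestr lebesgue_measure (measurable_itv `[0, 2 * pi[%R))
    (fun t : R => (cos t, sin t)).

(* |a|^(-g) for g > 0.  The inverse is taken in \bar R so that the value at
   a = 0 is +oo; powR would give 0 `^ (- g) = 0. *)
Definition abs_negpow (a g : R) : \bar R := ((`|a| `^ g)%:E)^-1%E.

(* The Hessian of a quadratic form is constant, so it is taken at 0. *)
Definition condCM P Q : Prop :=
  forall g : R, 0 < g < 2 / 3 ->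
    (\int[arc_length]_(x in unit_circle)
       abs_negpow (\det (x.1 *: hessian P 0 + x.2 *: hessian Q 0)) g < +oo)%E.

Definition condD P Q : Prop :=
  forall w : 'cV[R]_3, w != 0 ->
    ~ forall x, \det (row_mx (row_mx (grad P x) (grad Q x)) w : 'M[R]_3) = 0.

Definition polar F x y : R := (F (x + y) - F x - F y) / 2.

(* Rank of the Gram matrix of F|_H in a basis of H. *)
Definition rank_on F (H : {vspace 'cV[R]_3}) : nat :=
  \rank (\matrix_(i < \dim H, j < \dim H)
           polar F (vbasis H)`_i (vbasis H)`_j).

Definition is_max (A : set nat) (m : nat) : Prop :=
  A m /\ (forall k, A k -> (k <= m)%N).

Definition is_min (A : set nat) (m : nat) : Prop :=
  A m /\ (forall k, A k -> (m <= k)%N).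

Definition is_max_rank_on P Q (H : {vspace 'cV[R]_3}) (m : nat) : Prop :=
  is_max [set k | exists l1 l2 : R,
                    k = rank_on (fun x => l1 * P x + l2 * Q x) H] m.

Definition condR (d : nat) P Q : Prop :=
  is_min [set m | exists H : {vspace 'cV[R]_3},
                    \dim H = 2%N /\ is_max_rank_on P Q H m] d.

End QuadraticForms.

(* Main.v *)
Require Import Defs.
From mathcomp Require Import measurable_realfun ring lra.

(** Let A and B be the symmetric matrices of P and Q.  Everything is read off
    the binary cubic c(s,t) = det(sA + tB), which is a constant multiple of
    the determinant in the (CM) condition.

    On the unit circle |c|^(-g) can only blow up at the real zeros of c.  A
    simple zero contributes an integral like that of |t|^(-g), finite for
    g < 1; a double zero already makes the integral infinite at g = 1/2,
    which lies below 2/3.  A multiple zero of a real cubic is real, so (CM)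
    says that c has no squared linear factor (this includes c <> 0); this is
    [negpow_integrals_finite_iff].

    Two geometric facts about an irreducible pair replace the other
    conditions.  First, (D) fails exactly when some nonzero combination
    aA + bB has rank at most one ([rank1_not_condD], [not_condD_rank1]):
    if A x and B x are always proportional modulo w, then either the two
    quotient maps are proportional, and a combination has its image in the
    line of w, or both images lie in a common plane, which gives a common
    kernel vector and contradicts irreducibility.  Second, (R_2) fails exactly
    when there is a plane on which all combinations have rank at most one
    ([condR2P]); then both restrictions are multiples of one square.

    For part (1), a member of rank one or such a plane makes c divisible by a
    square ([rank1_square_factor], [flat_square_factor]).  Conversely, let N
    be the member of the pencil at a double zero of c and let N v = 0.  The
    derivative of det at N vanishes, so either N has rank at most one or v is
    isotropic for the whole pencil; in the second case v is in the radical of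
    every member restricted to the plane orthogonal to T v, where T is another
    member ([square_factor_degenerate]).

    For parts (2)-(4) it suffices to find three linear forms and an invertible
    recombination of P and Q that put the pair in the desired shape: the
    three forms are automatically independent, because a common zero of them
    would be a common kernel vector of A and B ([equivalent_of_forms]).  The
    forms are found by completing squares, starting from the rank one member
    in (2) and from the distinguished plane in (3) and (4). *)

Set Implicit Arguments.
Unset Strict Implicit.
Unset Printing Implicit Defensive.

(** * Integrals over the unit circle *)

Section CircleIntegral.
Context {R : realType}.
Local Open Scope ereal_scope.
Local Notation mu := (@lebesgue_measure R).

Lemma measurable_unit_circle : measurable (@unit_circle R).
Proof.
pose h := fun x : R * R => (x.1 ^+ 2 + x.2 ^+ 2)%R.
have mh : measurable_fun setT h.
  by apply: measurable_funD; apply: measurable_funX;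
     [exact: measurable_fst|exact: measurable_snd].
rewrite (_ : unit_circle = setT `&` h @^-1` [set 1%R]); last first.
  by rewrite setTI.
exact: mh.
Qed.

Lemma measurable_circle_param :
  measurable_fun setT (fun t : measurableTypeR R => (cos t, sin t) : R * R).
Proof.
apply: measurable_fun_pair.
  exact: (continuous_measurable_fun (@continuous_cos R)).
exact: (continuous_measurable_fun (@continuous_sin R)).
Qed.

(** The restricted Lebesgue measure on the whole line and Lebesgue measure on the
    parameter interval give the same integral because the complement of the
    interval is null for the former. *)
Lemma integral_arc_length (f : R * R -> \bar R) :
  measurable_fun setT f -> (forall x, 0 <= f x) ->
  \int[arc_length]_(x in unit_circle) f x =
  \int[mu]_(t in `[0%R, (2 * pi)%R[) f (cos t, sin t).
Proof.
move=> mf f0.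
set D : set (measurableTypeR R) := [set` `[0%R, (2 * pi)%R[].
have mD : measurable D by exact: measurable_itv.
rewrite /arc_length ge0_integral_pushforward//=; last 3 first.
- exact: measurable_circle_param.
- exact: measurable_unit_circle.
- exact: measurable_funS mf.
rewrite (_ : _ @^-1` _ = setT); last first.
  by apply/seteqP; split => // t _; rewrite /unit_circle /= cos2Dsin2.
have mg : measurable_fun setT (f \o (fun t : measurableTypeR R => (cos t, sin t) : R * R)).
  by apply: measurableT_comp => //; exact: measurable_circle_param.
rewrite (@ge0_negligible_integral _ (measurableTypeR R) _ _ _ (~` D))//=; last 2 first.
- exact: measurableC.
- by rewrite /mrestr setICl measure0.
rewrite setTD setCK.
by apply: eq_measure_integral => A mA AD; rewrite /= /mrestr setIidl.
Qed.

End CircleIntegral.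

(** * Integrals of a derivative over an open interval *)

Section FTC.
Context {R : realType}.
Local Notation mu := (@lebesgue_measure R).

Variables (F f : R -> R) (a b : R).
Hypothesis dF : forall x : R, a < x < b -> is_derive x 1 F (f x).
Hypothesis cf : forall x : R, a < x < b -> {for x, continuous f}.
Hypothesis f0 : forall x : R, a < x < b -> 0 <= f x.

Lemma FTC_subinterval (x y : R) : a < x -> x < y -> y < b ->
  (\int[mu]_(t in `[x, y]) (f t)%:E = (F y - F x)%:E)%E.
Proof.
move=> ax xy yb; rewrite EFinB; apply: continuous_FTC2 => //.
- apply: continuous_in_subspaceT => t; rewrite inE/= in_itv/= => /andP[xt ty].
  by apply: cf; rewrite (lt_le_trans ax)//= (le_lt_trans ty).
- have dd t : x <= t <= y -> derivable F t 1.
    move=> /andP[xt ty]; have h : a < t < b by rewrite (lt_le_trans ax)//= (le_lt_trans ty).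
    by have [] := dF h.
  have cc t : x <= t <= y -> {for t, continuous F}.
    by move=> /dd /derivable1_diffP /differentiable_continuous.
  split.
  + by move=> t; rewrite in_itv/= => /andP[xt ty]; apply: dd; rewrite !ltW.
  + by apply: cvg_at_right_filter; apply: cc; rewrite lexx ltW.
  + by apply: cvg_at_left_filter; apply: cc; rewrite lexx ltW.
- move=> t; rewrite in_itv/= => /andP[xt ty]; rewrite derive1E.
  have h : a < t < b by rewrite (lt_trans ax)//= (lt_trans ty).
  by have [] := dF h.
Qed.

Lemma open_continuous_measurable : measurable_fun `]a, b[ f.
Proof.
apply: open_continuous_measurable_fun => // x; rewrite inE/= in_itv/=.
exact: cf.
Qed.

(** Together with [FTC_open_le], this evaluates an integral whose integrand may
    blow up at both ends of the interval, knowing only the increments of F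
    strictly inside. *)
Lemma FTC_open_ge (x y : R) : a < x -> x < y -> y < b ->
  ((F y - F x)%:E <= \int[mu]_(t in `]a, b[) (f t)%:E)%E.
Proof.
move=> ax xy yb; rewrite -FTC_subinterval//; apply: ge0_subset_integral => //.
- by apply/measurable_EFinP; exact: open_continuous_measurable.
- move=> t; rewrite /= !in_itv/= => /andP[xt ty].
  by rewrite (lt_le_trans ax)//= (le_lt_trans ty).
Qed.

(** Exhaust the open interval by closed ones and pass to the limit by monotone
    convergence. *)
Lemma FTC_open_le (B : R) : 0 <= B ->
  (forall x y : R, a < x -> x < y -> y < b -> F y - F x <= B) ->
  (\int[mu]_(t in `]a, b[) (f t)%:E <= B%:E)%E.
Proof.
move=> B0 FB.
pose G n := [set` `[(a + n.+1%:R^-1)%R, (b - n.+1%:R^-1)%R]] : set R.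
have sub n : (0 : R) < n.+1%:R^-1 by rewrite invr_gt0.
have Gab n : G n `<=` `]a, b[.
  move=> t; rewrite /G /= !in_itv/= => /andP[h1 h2].
  by move: n.+1%:R^-1 (sub n) h1 h2 => e *; apply/andP; split; lra.
have GE : [set` `]a, b[] = \bigcup_n G n.
  apply/seteqP; split => t /=; last by move=> [n _ /Gab].
  rewrite in_itv/= => /andP[at_ tb].
  have h : 0 < Num.min (t - a) (b - t) by rewrite lt_min !subr_gt0 at_ tb.
  have [n _ /(_ n (leqnn n)) /=] := near_infty_natSinv_lt (PosNum h).
  rewrite lt_min => /andP[h1 h2]; exists n => //.
  rewrite /G /= in_itv/=; move: n.+1%:R^-1 h1 h2 => e *.
  by apply/andP; split; lra.
have cv : (\int[mu]_(x in G i) (f x)%:E @[i --> \oo] -->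
    \int[mu]_(x in \bigcup_i G i) (f x)%:E)%E.
  apply: ge0_nondecreasing_set_cvg_integral => //.
  - move=> m n mn; apply/subsetPset => t.
    rewrite /G /= !in_itv/= => /andP[h1 h2].
    have : (n.+1%:R^-1 : R) <= m.+1%:R^-1 by rewrite lef_pV2 ?posrE// ler_nat.
    move: n.+1%:R^-1 m.+1%:R^-1 h1 h2 => e e' *.
    by apply/andP; split; lra.
  - by move=> n; exact: measurable_itv.
  - move=> n; apply/measurable_EFinP.
    exact: measurable_funS open_continuous_measurable.
  - by move=> n x /Gab /=; rewrite in_itv/= => abx; rewrite lee_fin; exact: f0.
rewrite GE -(cvg_lim _ cv)//; apply: lime_le; first exact: cvgP cv.
near=> n.
rewrite /G; move: n.+1%:R^-1 (sub n) => e e0.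
have [xy|yx] := ltP (a + e) (b - e).
  rewrite FTC_subinterval//; [|lra..].
  by rewrite lee_fin; apply: FB => //; lra.
move: yx; rewrite le_eqVlt => /predU1P[eab|yx].
  by rewrite eab set_itv1 integral_set1.
by rewrite set_itv_ge ?integral_set0// bnd_simp -ltNge.
Unshelve. all: by end_near. Qed.
End FTC.

(** * Negative powers near simple and double zeros *)

Section Power.
Context {R : realType}.
Local Notation mu := (@lebesgue_measure R).
Implicit Types (a b g k : R).

Lemma abs_negpowE a g : 0 < g ->
  abs_negpow a g = if a == 0 then +oo%E else (`|a| `^ (- g))%:E.
Proof.
by move=> g0; rewrite /abs_negpow inver powR_eq0 normr_eq0 (gt_eqF g0) andbT powRN.
Qed.

Lemma abs_negpow_ge0 a g : (0 <= abs_negpow a g)%E.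
Proof. by rewrite /abs_negpow inve_ge0 lee_fin powR_ge0. Qed.

Lemma le_abs_negpow a b g : 0 < g -> `|a| <= `|b| ->
  (abs_negpow b g <= abs_negpow a g)%E.
Proof.
move=> g0 ab; rewrite !abs_negpowE//.
have [_|a0] := eqVneq a 0; first by rewrite leey.
have na : 0 < `|a| by rewrite normr_gt0.
rewrite -normr_eq0 gt_eqF ?(lt_le_trans na)// lee_fin !powRN lef_pV2 ?posrE ?powR_gt0//.
  by apply: ge0_ler_powR; rewrite ?nnegrE// ltW.
exact: lt_le_trans ab.
Qed.

Lemma abs_negpowM k a g : 0 < g -> k != 0 ->
  abs_negpow (k * a) g = ((`|k| `^ (- g))%:E * abs_negpow a g)%E.
Proof.
move=> g0 k0; rewrite !abs_negpowE// mulf_eq0 (negPf k0)/=.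
case: ifP => _; last by rewrite normrM powRM// EFinM.
by rewrite gt0_muley// lte_fin powR_gt0// normr_gt0.
Qed.

Lemma measurable_abs_negpow g : 0 < g ->
  measurable_fun setT (fun a : R => abs_negpow a g).
Proof.
move=> g0; under eq_fun do rewrite abs_negpowE//.
apply: measurable_fun_ifT => //=.
  by apply: measurable_fun_eqr.
apply/measurable_EFinP.
exact: (measurableT_comp (measurable_powR (- g)) (@normr_measurable R setT)).
Qed.

(** The sign sg makes one formula serve both sides of the point c. *)
Lemma is_derive_abs_pow (sg c t : R) g : sg ^+ 2 = 1 -> g != 1 -> 0 < sg * (t - c) ->
  is_derive t 1 (fun t => sg * (sg * (t - c)) `^ (1 - g) / (1 - g))
                ((sg * (t - c)) `^ (- g)).
Proof.
move=> s1 g1 tc.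
have d1 : is_derive t 1 (fun t : R => sg * (t - c)) sg.
  by apply: is_derive_eq; rewrite /= subr0 scaler1.
have d2 := is_derive1_powR (1 - g) tc.
have d3 := @is_derive1_comp R ((@powR R)^~ (1 - g)) (fun t : R => sg * (t - c)) t _ _ d2 d1.
have d4 : is_derive t 1
    (fun t => (sg / (1 - g)) * ((@powR R)^~ (1 - g) \o (fun t => sg * (t - c))) t)
    ((sg * (t - c)) `^ (- g)).
  apply: is_derive_eq; rewrite /GRing.scale/=.
  rewrite (_ : 1 - g - 1 = - g); last by ring.
  transitivity (sg ^+ 2 * (sg * (t - c)) `^ (- g) * ((1 - g) / (1 - g))); first by ring.
  by rewrite s1 mulfV ?mulr1 ?mul1r// subr_eq0 eq_sym.
by move: d4; congr is_derive; apply/funext => x /=; ring.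
Qed.

Lemma integral_abs_negpow_side (sg c a b : R) g : sg ^+ 2 = 1 -> 0 < g < 1 ->
  (forall t, a < t < b -> 0 < sg * (t - c)) ->
  (\int[mu]_(t in `]a, b[) abs_negpow (t - c) g < +oo)%E.
Proof.
move=> s1 /andP[g0 g1] pos.
have [ab|ba] := ltP a b; last first.
  by rewrite set_itv_ge ?integral_set0// bnd_simp -leNgt.
have s_abs : `|sg| = 1.
  by apply/eqP; rewrite -(@eqrXn2 _ 2)// ?expr1n -?normrX ?s1 ?normr1.
pose L := `|a - c| + `|b - c|.
pose B := 2 * (L `^ (1 - g) / (1 - g)).
have g1' : 0 < 1 - g by rewrite subr_gt0.
have B0 : 0 <= B by rewrite mulr_ge0// divr_ge0 ?powR_ge0 ?ltW.
have -> : (\int[mu]_(t in `]a, b[) abs_negpow (t - c) g =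
    \int[mu]_(t in `]a, b[) ((sg * (t - c)) `^ (- g))%:E)%E.
  apply: eq_integral => t; rewrite inE/= in_itv/= => /pos h; rewrite abs_negpowE//.
  have -> : `|t - c| = sg * (t - c) by rewrite -(gtr0_norm h) normrM s_abs mul1r.
  by case: eqP h => // ->; rewrite mulr0 ltxx.
apply: (@le_lt_trans _ _ B%:E); last by rewrite ltry.
have bd t : a < t < b ->
    `|sg * (sg * (t - c)) `^ (1 - g) / (1 - g)| <= L `^ (1 - g) / (1 - g).
  move=> h; rewrite !normrM s_abs mul1r (ger0_norm (powR_ge0 _ _)).
  rewrite (gtr0_norm (_ : 0 < (1 - g)^-1)) ?invr_gt0// ler_pM2r ?invr_gt0//.
  have st := pos _ h; apply: ge0_ler_powR; rewrite ?nnegrE ?(ltW g1') ?(ltW st)//.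
    by rewrite /L addr_ge0.
  rewrite -(gtr0_norm st) normrM s_abs mul1r /L ler_norml.
  move: h => /andP[h1 h2].
  have := ler_norm (b - c); have := ler_norm (- (a - c)); rewrite normrN.
  have := normr_ge0 (b - c); have := normr_ge0 (a - c).
  by move=> *; apply/andP; split; lra.
apply: (@FTC_open_le R (fun t : R => sg * (sg * (t - c)) `^ (1 - g) / (1 - g))) => //.
- move=> t h; apply: is_derive_abs_pow => //; last exact: pos.
  by rewrite lt_eqF.
- move=> t h; apply: differentiable_continuous; apply/derivable1_diffP.
  have d1 : is_derive t 1 (fun t : R => sg * (t - c)) sg.
    by apply: is_derive_eq; rewrite /= subr0 scaler1.
  have d2 := is_derive1_powR (- g) (pos _ h).
  by have [] := @is_derive1_comp R ((@powR R)^~ (- g)) (fun t : R => sg * (t - c)) t _ _ d2 d1.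
- by move=> t _; exact: powR_ge0.
- move=> x y ax xy yb.
  have := bd x; have := bd y.
  rewrite ax (lt_trans xy yb) yb (lt_trans ax xy) => /(_ isT) + /(_ isT).
  rewrite /B !ler_norml => /andP[_ h1] /andP[h2 _]; lra.
Qed.

Lemma measurable_abs_negpow_sub c g : 0 < g ->
  measurable_fun setT (fun t : R => abs_negpow (t - c) g).
Proof.
move=> g0; have mB : measurable_fun setT (fun t : R => t - c).
  by apply: measurable_funB.
exact: (measurableT_comp (measurable_abs_negpow g0) mB).
Qed.

Lemma integral_abs_negpow_finite (c a b g : R) : 0 < g < 1 ->
  (\int[mu]_(t in `[a, b[) abs_negpow (t - c) g < +oo)%E.
Proof.
move=> g01; have g0 : 0 < g by case/andP: g01.
have mf := measurable_abs_negpow_sub c g0.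
pose m := - `|a| - `|c| - 1; pose M := `|b| + `|c| + 1.
have na := ler_norm (- a); have nb := ler_norm b; have nc := ler_norm c.
have nc' := ler_norm (- c); rewrite !normrN in na nc'.
have n0 (x : R) := normr_ge0 x.
have mc : m < c by rewrite /m; move: (n0 a) => ?; lra.
have cM : c < M by rewrite /M; move: (n0 b) => ?; lra.
have sub (t : R) : a <= t < b -> m < t < c \/ c <= t < M.
  move=> /andP[h1 h2]; rewrite /m /M; move: (n0 c) (n0 a) (n0 b) => ? ? ?.
  have [tc|ct] := ltP t c; [left|right]; apply/andP; split => //; lra.
set U : set (measurableTypeR R) := `]m, c[%classic `|` `[c, M[%classic.
have h1 : (\int[mu]_(t in `[a, b[) abs_negpow (t - c) g <= \int[mu]_(t in U) abs_negpow (t - c) g)%E.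
  apply: ge0_subset_integral => //.
  - by apply: measurableU.
  - by apply: measurable_funTS.
  - by move=> t _; exact: abs_negpow_ge0.
apply: (le_lt_trans h1); rewrite ge0_integral_setU//; last 3 first.
- by apply: measurable_funTS.
- by move=> t _; exact: abs_negpow_ge0.
- apply/disj_setPS => t [] /=; rewrite !in_itv/= => /andP[_ tc] /andP[ct _].
  by move: (lt_le_trans tc ct); rewrite ltxx.
rewrite -integral_itv_obnd_cbnd//; last by apply: measurable_funTS.
rewrite lte_add_pinfty//.
- apply: (@integral_abs_negpow_side (-1)) => //; first by rewrite sqrrN expr1n.
  by move=> t /andP[_ h]; rewrite mulN1r oppr_gt0 subr_lt0.
- apply: (@integral_abs_negpow_side 1) => //; first by rewrite expr1n.
  by move=> t /andP[h _]; rewrite mul1r subr_gt0.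
Qed.

(** If |h| dominates the distance to a finite set of points, then |h|^(-g) is
    bounded by a finite sum of translates of a multiple of |t|^(-g). *)
Lemma integral_abs_negpow_simple_zeros (h : R -> R) (s : seq R) (k a b g : R) :
  measurable_fun setT h -> 0 < g < 1 -> 0 < k ->
  (forall t, a <= t < b -> exists2 c, c \in s & k * `|t - c| <= `|h t|) ->
  (\int[mu]_(t in `[a, b[) abs_negpow (h t) g < +oo)%E.
Proof.
move=> mh g01 k0 hs; have g0 : 0 < g by case/andP: g01.
have kg := powR_ge0 `|k| (- g).
apply: (@le_lt_trans _ _ (\int[mu]_(t in `[a, b[)
   (\sum_(c <- s) (`|k| `^ (- g))%:E * abs_negpow (t - c) g))%E).
  apply: ge0_le_integral => //.
  - by move=> t _; exact: abs_negpow_ge0.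
  - apply: measurable_funTS.
    exact: (measurableT_comp (measurable_abs_negpow g0)).
  - apply: emeasurable_sum => c; apply: measurable_funTS; apply: measurable_funeM.
    exact: measurable_abs_negpow_sub.
  - move=> t; rewrite /= in_itv/= => /hs[c cs hc].
    rewrite (big_rem c)//=; apply: (@le_trans _ _ (abs_negpow (k * (t - c)) g)).
      by apply: le_abs_negpow => //; rewrite normrM (gtr0_norm k0).
    rewrite abs_negpowM ?gt_eqF//; apply: leeDl; apply: sume_ge0 => d _.
    by rewrite mule_ge0 ?lee_fin// abs_negpow_ge0.
rewrite ge0_integral_sum//; last 2 first.
- move=> c; apply: measurable_funTS; apply: measurable_funeM.
  exact: measurable_abs_negpow_sub.
- by move=> c t _; rewrite mule_ge0 ?lee_fin// abs_negpow_ge0.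
apply: lte_sum_pinfty => c _; rewrite ge0_integralZl_EFin//.
- by rewrite lte_mul_pinfty ?lee_fin// integral_abs_negpow_finite.
- by move=> t _; exact: abs_negpow_ge0.
- by apply: measurable_funTS; exact: measurable_abs_negpow_sub.
Qed.

(** At the exponent 1/2 a double zero at c gives an integrand of order
    1/|t - c|, whose primitive, a logarithm, is unbounded. *)
Lemma integral_abs_negpow_double_zero (h : R -> R) (c k a b : R) :
  measurable_fun setT h -> 0 < k -> a <= c -> c < b ->
  (forall t, c < t < b -> `|h t| <= k * (t - c) ^+ 2) ->
  (\int[mu]_(t in `[a, b[) abs_negpow (h t) 2^-1 = +oo)%E.
Proof.
move=> mh k0 ac cb hk.
have g0 : 0 < 2^-1 :> R by rewrite invr_gt0.
have mg : measurable_fun setT (fun t => abs_negpow (h t) 2^-1).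
  exact: (measurableT_comp (measurable_abs_negpow g0)).
pose r := Num.sqrt k; have r0 : 0 < r by rewrite sqrtr_gt0.
have rk : r ^+ 2 = k by rewrite sqr_sqrtr// ltW.
apply/eqP; rewrite -leye_eq.
apply: (@le_trans _ _ (\int[mu]_(t in `]c, b[) abs_negpow (r * (t - c)) 1)%E); last first.
  apply: (@le_trans _ _ (\int[mu]_(t in `]c, b[) abs_negpow (h t) 2^-1)%E); last first.
    apply: ge0_subset_integral => //.
    - by apply: measurable_funTS.
    - by move=> t _; exact: abs_negpow_ge0.
    - move=> t; rewrite /= !in_itv/= => /andP[h1 ->]; rewrite andbT.
      exact: ltW (le_lt_trans ac h1).
  apply: ge0_le_integral => //.
  - by move=> t _; exact: abs_negpow_ge0.
  - apply: measurable_funTS.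
    have mB : measurable_fun setT (fun t : R => r * (t - c)).
      by apply: measurable_funM => //; apply: measurable_funB.
    exact: (measurableT_comp (measurable_abs_negpow ltr01) mB).
  - by apply: measurable_funTS.
  - move=> t; rewrite /= in_itv/= => /hk ht.
    apply: (@le_trans _ _ (abs_negpow (k * (t - c) ^+ 2) 2^-1)); last first.
      by apply: le_abs_negpow => //; rewrite (le_trans ht)// ler_norm.
    rewrite -rk -exprMn /abs_negpow (ger0_norm (sqr_ge0 _)) powR12_sqrt ?sqr_ge0//.
    by rewrite sqrtr_sqr powRr1.
have -> : (\int[mu]_(t in `]c, b[) abs_negpow (r * (t - c)) 1 =
    \int[mu]_(t in `]c, b[) (r^-1 * (t - c)^-1)%:E)%E.
  apply: eq_integral => t; rewrite inE/= in_itv/= => /andP[ct _].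
  have tc : 0 < t - c by rewrite subr_gt0.
  rewrite abs_negpowE// mulf_eq0 !gt_eqF//= powRN powRr1// normrM !gtr0_norm//.
  by rewrite invfM.
rewrite leye_eq; apply/eqP/eqyP => M M0.
pose d := (b - c) / 2; have d0 : 0 < d by rewrite divr_gt0// subr_gt0.
(* chosen so that the increment of the primitive ln (t - c) / r on
   [c + e, c + d] is exactly M *)
pose e := d * expR (- (r * M)).
have e0 : 0 < e by rewrite mulr_gt0// expR_gt0.
have ed : e < d by rewrite gtr_pMr// -expR0 ltr_expR oppr_lt0 mulr_gt0.
have -> : M = r^-1 * ln (c + d - c) - r^-1 * ln (c + e - c).
  rewrite !(addrC c) !addrK -mulrBr /e lnM ?posrE ?expR_gt0// expRK.
  by rewrite opprD addrA subrr sub0r opprK mulKf// gt_eqF.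
apply: (@FTC_open_ge R (fun t : R => r^-1 * ln (t - c)) (fun t => r^-1 * (t - c)^-1)).
- move=> t /andP[ct _]; have tc : 0 < t - c by rewrite subr_gt0.
  have d1 : is_derive t 1 (fun t : R => t - c) 1.
    by apply: is_derive_eq; rewrite subr0.
  have d2 := @is_derive1_comp R (@ln R) (fun t : R => t - c) t _ _ (is_derive1_ln tc) d1.
  by apply: is_derive_eq; rewrite /GRing.scale/= mulr1.
- move=> t /andP[ct _]; have tc : 0 < t - c by rewrite subr_gt0.
  apply: cvgM; first exact: cvg_cst.
  apply: cvgV; first by rewrite gt_eqF.
  by apply: cvgB; [exact: cvg_id|exact: cvg_cst].
- move=> t /andP[ct _].
  by rewrite mulr_ge0 ?invr_ge0 ?(ltW r0)// subr_ge0 ltW.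
- by rewrite ltrDl.
- by rewrite ltrD2l.
- by rewrite /d; move: cb => ?; lra.
Qed.

End Power.

(** * Linear forms on the unit circle *)

Section Trig.
Context {R : realType}.

Lemma sin_mvt (v : R) : 0 <= v -> exists2 u, 0 <= u <= v & sin v = v * cos u.
Proof.
move=> v0; have cs : {within `[0, v], continuous (@sin R)}.
  by apply: continuous_subspaceT => x; exact: continuous_sin.
have [u uv] := MVT_segment v0 (fun x _ => is_derive_sin x) cs.
by rewrite sin0 !subr0 mulrC => e; exists u => //; move: uv; rewrite in_itv.
Qed.

Lemma norm_sin_le (v : R) : `|sin v| <= `|v|.
Proof.
wlog v0 : v / 0 <= v.
  move=> H; have [/H//|/ltW] := leP 0 v.
  by rewrite -oppr_ge0 => /H; rewrite sinN !normrN.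
have [u _ ->] := sin_mvt v0.
by rewrite normrM ler_piMr// cos_max.
Qed.

(** For v nonnegative: if cos v is at least 1/2 then sin v is at least v/2 by the mean value
    theorem; otherwise sin v exceeds 1/2, while v is less than 2. *)
Lemma norm_sin_ge (v : R) : `|v| <= pi / 2 -> 4^-1 * `|v| <= `|sin v|.
Proof.
wlog v0 : v / 0 <= v.
  move=> H; have [/H//|/ltW] := leP 0 v.
  by rewrite -oppr_ge0 => /H; rewrite sinN !normrN.
rewrite (ger0_norm v0) => vpi.
have p2 := @pihalf_lt2 R; have p0 := @pi_gt0 R.
have s0 : 0 <= sin v by apply: sin_ge0_pi; apply/andP; split; lra.
have c0 : 0 <= cos v by apply: cos_ge0_pihalf; apply/andP; split; lra.
rewrite (ger0_norm s0).
have [c2|c2] := leP (1/2) (cos v); last first.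
  have := cos2Dsin2 v => e.
  have : (1 / 2) ^+ 2 <= sin v ^+ 2 by nra.
  by rewrite ler_sqr ?nnegrE//; lra.
have [u /andP[u0 uv] ->] := sin_mvt v0.
have cu : cos v <= cos u.
  have [->//|nvu] := eqVneq v u.
  apply: ltW; rewrite ltr_cos ?in_itv/=; [|lra..].
  by rewrite lt_neqAle eq_sym nvu.
nra.
Qed.

(** Amplitude and phase of a trigonometric linear form.  The window for the phase
    keeps the zero phi inside the parameter interval [0, 2 pi[ and at distance
    at most 3 pi / 2 from all of its points. *)
Lemma norm_linear_trig (a b : R) : exists r phi : R,
  [/\ 0 <= r, r ^+ 2 = a ^+ 2 + b ^+ 2, pi / 2 <= phi <= pi + pi / 2 &
      forall t, `|a * cos t + b * sin t| = r * `|sin (t - phi)|].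
Proof.
wlog b0 : a b / 0 <= b.
  move=> H; have [/H//|/ltW] := leP 0 b; rewrite -oppr_ge0 => /(H (- a))[r [phi []]].
  rewrite !sqrrN => r0 r2 phir e; exists r, phi; split => // t.
  by rewrite -e -normrN opprD !mulNr.
pose r := Num.sqrt (a ^+ 2 + b ^+ 2).
have r0 : 0 <= r by exact: sqrtr_ge0.
have r2 : r ^+ 2 = a ^+ 2 + b ^+ 2 by rewrite sqr_sqrtr// addr_ge0 ?sqr_ge0.
have [re|rn] := eqVneq r 0.
  exists r, (pi / 2); split => //.
    by have := @pi_gt0 R => ?; apply/andP; split; lra.
  have [-> ->] : a = 0 /\ b = 0 by move: r2; rewrite re => r2; split; nra.
  by move=> t; rewrite re !mul0r addr0 normr0.
have rp : 0 < r by rewrite lt_def rn.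
have bd : -1 <= a / r <= 1.
  have ra : `|a| <= r by rewrite -ler_sqr ?nnegrE// real_normK ?num_real// r2 lerDl sqr_ge0.
  by rewrite -ler_norml normrM normfV (gtr0_norm rp) ler_pdivrMr// mul1r.
pose psi := acos (a / r).
have c1 : cos psi = a / r by rewrite acosK.
have s1 : sin psi = b / r.
  have s0 : 0 <= sin psi.
    by apply: sin_ge0_pi; rewrite acos_ge0// acos_lepi.
  apply/eqP; rewrite -(@eqrXn2 _ 2) ?divr_ge0// sin2cos2 c1 !expr_div_n r2.
  have ab : a ^+ 2 + b ^+ 2 != 0 by rewrite -r2 sqrf_eq0.
  by apply/eqP; field.
exists r, (psi + pi / 2); split => //.
  have := acos_ge0 bd; have := acos_lepi bd; rewrite -/psi => ? ?.
  by apply/andP; split; lra.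
move=> t; rewrite opprD addrA sinBpihalf normrN cosB c1 s1.
have -> : a * cos t + b * sin t = r * (cos t * (a / r) + sin t * (b / r)) by field.
by rewrite normrM (gtr0_norm rp).
Qed.

(** The zeros of the form that can be nearest to a point of [0, 2 pi[ are phi - pi,
    phi and phi + pi. *)
Lemma norm_linear_trig_ge (p q : R) : p != 0 \/ q != 0 ->
  exists (s : seq R) (k : R), 0 < k /\
    forall t : R, 0 <= t < 2 * pi ->
      exists2 c, c \in s & k * `|t - c| <= `|p * cos t + q * sin t|.
Proof.
move=> pq; have [r [phi [r0 r2 /andP[phi1 phi2] e]]] := norm_linear_trig p q.
have rp : 0 < r.
  rewrite lt_def r0 andbT; apply/eqP => re; move: r2; rewrite re expr0n/=.
  by case: pq => /eqP pq h; apply: pq; nra.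
exists [:: phi - pi; phi; phi + pi], (r / 4); split; first by rewrite divr_gt0.
move=> t /andP[t0 t2]; rewrite e.
have close d : `|sin d| = `|sin (t - phi)| -> `|d| <= pi / 2 ->
    r / 4 * `|d| <= r * `|sin (t - phi)|.
  by move=> <- /norm_sin_ge h; rewrite -mulrA ler_pM2l.
have [h1|h1] := ltP (t - phi) (- (pi / 2)).
  exists (phi - pi); rewrite ?inE ?eqxx//; apply: close; last first.
    by rewrite ler_norml; apply/andP; split; lra.
  by rewrite opprB addrCA addrC sinDpi normrN.
have [h2|h2] := leP (t - phi) (pi / 2).
  exists phi; rewrite ?inE ?eqxx ?orbT//; apply: close => //.
  by rewrite ler_norml h1.
exists (phi + pi); rewrite ?inE ?eqxx ?orbT//; apply: close; last first.
  by rewrite ler_norml; apply/andP; split; lra.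
by rewrite -[in RHS](subrK pi (t - phi)) sinDpi normrN opprD addrA.
Qed.
End Trig.

(** * Binary cubics on the unit circle *)

Section Cubic.
Context {R : realType}.
Local Notation mu := (@lebesgue_measure R).
Implicit Types c : R -> R -> R.

Definition binary_cubic c := exists c0 c1 c2 c3 : R, forall x y,
  c x y = c0 * x ^+ 3 + c1 * x ^+ 2 * y + c2 * x * y ^+ 2 + c3 * y ^+ 3.

(** No factor is required to be nonzero, so that the zero cubic has a square
    factor. *)
Definition has_square_factor c := exists p q r s : R, forall x y,
  c x y = (p * x + q * y) ^+ 2 * (r * x + s * y).

Lemma monic_cubic_root (a b d : R) : exists x, x ^+ 3 + a * x ^+ 2 + b * x + d = 0.
Proof.
(* beyond K the leading term dominates, so the cubic changes sign on [-K, K] *)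
pose K := 1 + `|a| + `|b| + `|d|.
have K1 : 1 <= K by rewrite /K -!addrA lerDl !addr_ge0.
have b1 : `|a * K ^+ 2 + d| + `|b * K| <= K ^+ 3.
  rewrite (_ : K ^+ 3 = K ^+ 2 + `|a| * K ^+ 2 + `|b| * K ^+ 2 + `|d| * K ^+ 2); last first.
    by rewrite exprS {1}/K; ring.
  have Kn : `|K| = K by rewrite ger0_norm// (le_trans _ K1).
  have := ler_normD (a * K ^+ 2) d; rewrite !normrM Kn.
  have K2 : K <= K * K by rewrite ler_peMl// (le_trans _ K1).
  have := ler_wpM2l (normr_ge0 b) K2.
  have := ler_wpM2l (normr_ge0 d) (le_trans K1 K2).
  by rewrite !expr2; have := le_trans K1 K2; lra.
pose P := 'X^3 + a *: 'X^2 + b *: 'X + d%:P : {poly R}.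
have PE x : P.[x] = x ^+ 3 + a * x ^+ 2 + b * x + d by rewrite /P !hornerE.
have := ler_norm (a * K ^+ 2 + d); have := ler_norm (- (a * K ^+ 2 + d)).
have := ler_norm (b * K); have := ler_norm (- (b * K)); rewrite !normrN => ? ? ? ?.
have KK : - K <= K by lra.
have PK : P.[- K] <= 0 <= P.[K] by rewrite !PE; apply/andP; split; lra.
by have [x _ /rootP] := poly_ivt KK PK; rewrite PE => Px; exists x.
Qed.

Lemma binary_cubic_linear_factor c : binary_cubic c ->
  exists p q a b d : R, forall x y,
    c x y = (p * x + q * y) * (a * x ^+ 2 + b * x * y + d * y ^+ 2).
Proof.
move=> [c0 [c1 [c2 [c3 e]]]].
have [z|nz] := eqVneq c0 0.
  by exists 0, 1, c1, c2, c3 => x y; rewrite e z; ring.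
have [x0 hx] := monic_cubic_root (c1 / c0) (c2 / c0) (c3 / c0).
exists 1, (- x0), c0, (c1 + c0 * x0), (c2 + x0 * (c1 + c0 * x0)) => x y.
have e3 : c3 = - (c0 * x0 ^+ 3 + c1 * x0 ^+ 2 + c2 * x0).
  have : c0 * (x0 ^+ 3 + c1 / c0 * x0 ^+ 2 + c2 / c0 * x0 + c3 / c0) = 0.
    by rewrite hx mulr0.
  rewrite (_ : c0 * _ = c0 * x0 ^+ 3 + c1 * x0 ^+ 2 + c2 * x0 + c3); last by field.
  lra.
by rewrite e e3; ring.
Qed.

Lemma parallel_forms (p q p' q' : R) : p * q' = p' * q ->
  exists u v l m : R, [/\ p = l * u, q = l * v, p' = m * u & q' = m * v].
Proof.
move=> h; have [p0|p0] := eqVneq p 0; last first.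
  exists p, q, 1, (p' / p); split; rewrite ?mul1r//; first by field.
  by rewrite mulrAC -h mulrC mulKf.
have [q0|q0] := eqVneq q 0.
  by exists p', q', 0, 1; rewrite !mul0r !mul1r.
exists p, q, 1, (q' / q); rewrite !mul1r; split => //; last by field.
by rewrite mulrAC [q' * p]mulrC h mulfK.
Qed.

(** Two independent linear forms determine the point (x, y), so they cannot both
    be small on the unit circle. *)
Lemma norm_form_pair_ge (p q p' q' : R) : p * q' - p' * q != 0 ->
  exists2 d, 0 < d & forall x y, x ^+ 2 + y ^+ 2 = 1 ->
    d <= `|p * x + q * y| \/ d <= `|p' * x + q' * y|.
Proof.
move=> D0; pose D := p * q' - p' * q.
pose T := p ^+ 2 + q ^+ 2 + p' ^+ 2 + q' ^+ 2 + 1.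
have T1 : 1 <= T by rewrite /T lerDr !addr_ge0 ?sqr_ge0.
have T0 : 0 < T by apply: lt_le_trans T1.
pose d := `|D| / (2 * T).
have d0 : 0 < d by rewrite divr_gt0 ?normr_gt0// mulr_gt0.
have dD : 4 * T ^+ 2 * d ^+ 2 = D ^+ 2.
  by rewrite /d expr_div_n real_normK ?num_real//; field; rewrite gt_eqF.
exists d => // x y xy; pose L := p * x + q * y; pose L' := p' * x + q' * y.
rewrite -/L -/L'; have [|Ld] := leP d `|L|; first by left.
have [|Ld'] := leP d `|L'|; first by right.
have sq z : `|z| < d -> z ^+ 2 < d ^+ 2.
  by move=> zd; rewrite -(real_normK (num_real z)) ltr_sqr ?nnegrE// ltW.
have {}Ld := sq _ Ld; have {}Ld' := sq _ Ld'.
have : D ^+ 2 <= 2 * T * (L ^+ 2 + L' ^+ 2).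
  rewrite (_ : D ^+ 2 = (q' * L - q * L') ^+ 2 + (p * L' - p' * L) ^+ 2); last first.
    rewrite -[LHS]mulr1 -[X in _ * X]xy /D /L /L'; ring.
  have h (u v : R) : (u - v) ^+ 2 <= 2 * (u ^+ 2 + v ^+ 2).
    by have := sqr_ge0 (u + v) => ?; nra.
  apply: le_trans (lerD (h _ _) (h _ _)) _; rewrite !exprMn /T.
  rewrite -subr_ge0 (_ : _ - _ = 2 * ((q' ^+ 2 + p' ^+ 2 + 1) * L' ^+ 2 +
    (q ^+ 2 + p ^+ 2 + 1) * L ^+ 2)); last by ring.
  by rewrite mulr_ge0// addr_ge0// mulr_ge0 ?sqr_ge0// !addr_ge0 ?sqr_ge0.
rewrite -dD => h; exfalso.
have : 2 * T * (L ^+ 2 + L' ^+ 2) < 2 * T * (2 * d ^+ 2).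
  by rewrite ltr_pM2l ?mulr_gt0//; lra.
have : 0 < d ^+ 2 by rewrite exprn_gt0.
have : T * d ^+ 2 <= T ^+ 2 * d ^+ 2 by rewrite ler_pM2r ?exprn_gt0// expr2 ler_peMl// ltW.
lra.
Qed.

(** The cubics of interest are bounded below, near any point of the circle, by one
    of at most three linear forms; this turns such a bound into one by the
    distance to a finite set of parameters. *)
Lemma three_forms_lower_bound c (p1 q1 p2 q2 p3 q3 d : R) : 0 < d ->
  p1 != 0 \/ q1 != 0 -> p2 != 0 \/ q2 != 0 -> p3 != 0 \/ q3 != 0 ->
  (forall x y, x ^+ 2 + y ^+ 2 = 1 ->
    [\/ d * `|p1 * x + q1 * y| <= `|c x y|,
        d * `|p2 * x + q2 * y| <= `|c x y| | d * `|p3 * x + q3 * y| <= `|c x y|]) ->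
  exists (s : seq R) (k : R), 0 < k /\ forall t : R, 0 <= t < 2 * pi ->
    exists2 a, a \in s & k * `|t - a| <= `|c (cos t) (sin t)|.
Proof.
move=> d0 /norm_linear_trig_ge[s1 [k1 [k10 h1]]] /norm_linear_trig_ge[s2 [k2 [k20 h2]]].
move=> /norm_linear_trig_ge[s3 [k3 [k30 h3]]] hc.
pose k := Num.min k1 (Num.min k2 k3).
have [kk1 kk2 kk3] : [/\ k <= k1, k <= k2 & k <= k3] by rewrite /k !ge_min !lexx !orbT.
exists (s1 ++ s2 ++ s3), (d * k); split; first by rewrite mulr_gt0// /k !lt_min k10 k20.
have step (k' a t u : R) : k <= k' -> k' * `|t - a| <= `|u| -> d * k * `|t - a| <= d * `|u|.
  move=> kk' h; rewrite -mulrA ler_pM2l// (le_trans _ h)// ler_wpM2r//.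
move=> t tpi; case: (hc _ _ (cos2Dsin2 t)) => h.
- by have [a ha /(step _ _ _ _ kk1) h'] := h1 t tpi; exists a; rewrite ?mem_cat ?ha// (le_trans h').
- by have [a ha /(step _ _ _ _ kk2) h'] := h2 t tpi; exists a; rewrite ?mem_cat ?ha ?orbT// (le_trans h').
- by have [a ha /(step _ _ _ _ kk3) h'] := h3 t tpi; exists a; rewrite ?mem_cat ?ha ?orbT// (le_trans h').
Qed.

(** Complete the square with respect to x and to y and add the two identities. *)
Lemma definite_ge (a b d : R) : b ^+ 2 < 4 * a * d ->
  exists2 e, 0 < e & forall x y, x ^+ 2 + y ^+ 2 = 1 ->
    e <= `|a * x ^+ 2 + b * x * y + d * y ^+ 2|.
Proof.
move=> D0; pose D := 4 * a * d - b ^+ 2; have D1 : 0 < D by rewrite subr_gt0.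
pose S := 4 * (`|a| + `|d| + 1).
have S0 : 0 < S by rewrite mulr_gt0// ltr_wpDl// addr_ge0.
exists (D / S) => [|x y xy]; first exact: divr_gt0.
set q := _ + _ + _; rewrite ler_pdivrMr//.
have e1 : 4 * a * q = (2 * a * x + b * y) ^+ 2 + D * y ^+ 2 by rewrite /q /D; ring.
have e2 : 4 * d * q = (b * x + 2 * d * y) ^+ 2 + D * x ^+ 2 by rewrite /q /D; ring.
have : D <= 4 * a * q + 4 * d * q.
  have eD : D = D * x ^+ 2 + D * y ^+ 2 by rewrite -mulrDr xy mulr1.
  rewrite e1 e2 {1}eD.
  have := sqr_ge0 (2 * a * x + b * y); have := sqr_ge0 (b * x + 2 * d * y).
  by lra.
have := ler_norm (a * q); have := ler_norm (d * q); rewrite !normrM /S.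
by have := normr_ge0 q; nra.
Qed.

Lemma quadratic_split (a b d : R) : 4 * a * d <= b ^+ 2 ->
  exists p q p' q' : R, forall x y,
    a * x ^+ 2 + b * x * y + d * y ^+ 2 = (p * x + q * y) * (p' * x + q' * y).
Proof.
move=> D0; have [a0|a0] := eqVneq a 0.
  by exists 0, 1, b, d => x y; rewrite a0; ring.
pose s := Num.sqrt (b ^+ 2 - 4 * a * d).
have s2 : s ^+ 2 = b ^+ 2 - 4 * a * d by rewrite sqr_sqrtr// subr_ge0.
exists (2^-1), ((b + s) / (4 * a)), (2 * a), (b - s) => x y.
have -> : d = (b ^+ 2 - s ^+ 2) / (4 * a) by rewrite s2; field.
by field.
Qed.

(** A real cubic is a linear form times a quadratic form q.  If q is definite, it
    is bounded below.  If it splits, there are three linear forms; they are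
    pairwise independent in the absence of a square factor, so at each point of
    the circle at least two of them are bounded below and the product is bounded
    below by the third. *)
Lemma simple_zeros_lower_bound c : binary_cubic c -> ~ has_square_factor c ->
  exists (s : seq R) (k : R), 0 < k /\ forall t : R, 0 <= t < 2 * pi ->
    exists2 a, a \in s & k * `|t - a| <= `|c (cos t) (sin t)|.
Proof.
move=> /binary_cubic_linear_factor[p [q [a [b [d e]]]]] nsq.
have nz (u v : R) : ~ (u = 0 /\ v = 0) -> u != 0 \/ v != 0.
  move=> h; have [u0|] := eqVneq u 0; last by left.
  by right; apply/eqP => v0; apply: h.
have pq : p != 0 \/ q != 0.
  apply: nz => -[p0 q0]; apply: nsq; exists 0, 0, 0, 0 => x y.
  by rewrite e p0 q0; ring.
have [D|D] := ltP (b ^+ 2) (4 * a * d).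
  have [f f0 hf] := definite_ge D.
  apply: (three_forms_lower_bound f0 pq pq pq) => x y xy; apply: Or31.
  by rewrite e normrM mulrC ler_wpM2l// hf.
have [p2 [q2 [p3 [q3 eq]]]] := quadratic_split D.
have {}e x y : c x y = (p * x + q * y) * (p2 * x + q2 * y) * (p3 * x + q3 * y).
  by rewrite e eq mulrA.
have d12 : p * q2 - p2 * q != 0.
  apply/eqP => /subr0_eq/parallel_forms[u [v [l [m [? ? ? ?]]]]]; apply: nsq.
  by exists u, v, (l * m * p3), (l * m * q3) => x y; rewrite e; subst; ring.
have d13 : p * q3 - p3 * q != 0.
  apply/eqP => /subr0_eq/parallel_forms[u [v [l [m [? ? ? ?]]]]]; apply: nsq.
  by exists u, v, (l * m * p2), (l * m * q2) => x y; rewrite e; subst; ring.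
have d23 : p2 * q3 - p3 * q2 != 0.
  apply/eqP => /subr0_eq/parallel_forms[u [v [l [m [? ? ? ?]]]]]; apply: nsq.
  by exists u, v, (l * m * p), (l * m * q) => x y; rewrite e; subst; ring.
have [f12 f120 h12] := norm_form_pair_ge d12.
have [f13 f130 h13] := norm_form_pair_ge d13.
have [f23 f230 h23] := norm_form_pair_ge d23.
pose f := Num.min f12 (Num.min f13 f23).
have f0 : 0 < f by rewrite /f !lt_min f120 f130.
have [ff12 ff13 ff23] : [/\ f <= f12, f <= f13 & f <= f23] by rewrite /f !ge_min !lexx !orbT.
have pq2 : p2 != 0 \/ q2 != 0.
  by apply: nz => -[z1 z2]; move: d12; rewrite z1 z2 mulr0 mul0r subrr eqxx.
have pq3 : p3 != 0 \/ q3 != 0.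
  by apply: nz => -[z1 z2]; move: d13; rewrite z1 z2 mulr0 mul0r subrr eqxx.
apply: (three_forms_lower_bound (exprn_gt0 2 f0) pq pq2 pq3) => x y xy; rewrite e !normrM.
have prod (u v w : R) : f <= `|u| -> f <= `|v| -> f ^+ 2 * `|w| <= `|u| * `|v| * `|w|.
  by move=> fu fv; rewrite ler_wpM2r// expr2 ler_pM// ltW.
case: (h12 _ _ xy) => /(le_trans ff12) h1.
  case: (h23 _ _ xy) => /(le_trans ff23) h2.
    by apply: Or33; apply: prod.
  by apply: Or32; rewrite [leRHS]mulrAC; apply: prod.
case: (h13 _ _ xy) => /(le_trans ff13) h2.
  by apply: Or33; apply: prod.
by apply: Or31; rewrite -[leRHS]mulrA [leRHS]mulrC; apply: prod.
Qed.

Lemma square_factor_double_zero c : has_square_factor c ->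
  exists k phi : R, [/\ 0 < k, 0 <= phi, phi < 2 * pi &
    forall t, `|c (cos t) (sin t)| <= k * (t - phi) ^+ 2].
Proof.
move=> [p [q [r [s e]]]].
have [l [phi [l0 _ /andP[phi1 phi2] hphi]]] := norm_linear_trig p q.
have p0 := @pi_gt0 R.
exists (l ^+ 2 * (`|r| + `|s|) + 1), phi; split; [|lra|lra|move=> t].
  by rewrite ltr_wpDl// mulr_ge0 ?sqr_ge0// addr_ge0.
rewrite e normrM normrX hphi exprMn.
have h1 : `|r * cos t + s * sin t| <= `|r| + `|s|.
  by rewrite (le_trans (ler_normD _ _))// !normrM lerD// ler_piMr// ?cos_max ?sin_max.
have h2 : `|sin (t - phi)| ^+ 2 <= (t - phi) ^+ 2.
  by rewrite -(real_normK (num_real (t - phi))) ler_sqr ?nnegrE// norm_sin_le.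
have h3 := sqr_ge0 (t - phi); have h4 := sqr_ge0 l.
rewrite mulrDl mul1r; apply: ler_wpDr => //.
rewrite -[leLHS]mulrA -[leRHS]mulrA ler_wpM2l// [leRHS]mulrC ler_pM// exprn_ge0//.
Qed.

(** The criterion of integrability behind (CM): the threshold 2/3 lies between 1/2,
    where a double zero diverges, and 1, below which simple zeros converge. *)
Lemma negpow_integrals_finite_iff c : binary_cubic c ->
  (forall g : R, 0 < g < 2 / 3 ->
     (\int[arc_length]_(x in unit_circle) abs_negpow (c x.1 x.2) g < +oo)%E) <->
  ~ has_square_factor c.
Proof.
move=> hc; have [c0 [c1 [c2 [c3 e]]]] := hc.
have mc : measurable_fun setT (fun x : R * R => c x.1 x.2).
  under eq_fun do rewrite e.
  have m1 := @measurable_fst _ _ R R; have m2 := @measurable_snd _ _ R R.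
  by repeat apply: measurable_funD; repeat apply: measurable_funM => //;
     apply: measurable_funX.
have E g : 0 < g -> (\int[arc_length]_(x in unit_circle) abs_negpow (c x.1 x.2) g =
    \int[mu]_(t in `[0%R, (2 * pi)%R[) abs_negpow (c (cos t) (sin t)) g)%E.
  move=> g0; rewrite integral_arc_length//; last by move=> x; exact: abs_negpow_ge0.
  exact: (measurableT_comp (measurable_abs_negpow g0) mc).
have mt : measurable_fun setT (fun t : R => c (cos t) (sin t)).
  exact: (measurableT_comp mc measurable_circle_param).
split=> [h sq|nsq g /andP[g0 g1]].
  have [k [phi [k0 phi0 phi2 hphi]]] := square_factor_double_zero sq.
  have h1 : 0 < (2^-1 : R) < 2 / 3 by apply/andP; split; lra.
  have := h _ h1; rewrite E//.
  by rewrite (@integral_abs_negpow_double_zero _ _ phi k).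
have [s [k [k0 hs]]] := simple_zeros_lower_bound hc nsq.
rewrite E//; apply: (@integral_abs_negpow_simple_zeros _ _ s k) => //.
by rewrite g0/=; lra.
Qed.

End Cubic.

(** * Gram matrices of ternary quadratic forms *)

Section Coordinates.
Context {R : realType}.
Implicit Types (A B M S T : 'M[R]_3) (x y v w u : 'cV[R]_3).

Lemma sum_ord3 (V : zmodType) (F : 'I_3 -> V) : \sum_(i < 3) F i = F 0 + F 1 + F 2.
Proof.
rewrite !big_ord_recl big_ord0 addr0 addrA.
by congr (F _ + F _ + F _); apply: val_inj.
Qed.

Lemma forall_ord3 (p : 'I_3 -> Prop) : p 0 -> p 1 -> p 2 -> forall i, p i.
Proof.
move=> p0 p1 p2 [[|[|[|]]]//= h].
- by rewrite (_ : Ordinal _ = 0)//; apply: val_inj.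
- by rewrite (_ : Ordinal _ = 1)//; apply: val_inj.
- by rewrite (_ : Ordinal _ = 2)//; apply: val_inj.
Qed.

Lemma det_mx3 A : \det A =
  A 0 0 * (A 1 1 * A 2 2 - A 1 2 * A 2 1) - A 0 1 * (A 1 0 * A 2 2 - A 1 2 * A 2 0)
  + A 0 2 * (A 1 0 * A 2 1 - A 1 1 * A 2 0).
Proof.
pose f m n := A (inord m) (inord n).
have AE i j : A i j = f (val i) (val j) by rewrite /f !inord_val.
rewrite (expand_det_row _ 0) !big_ord_recl big_ord0 /cofactor.
rewrite !(expand_det_row _ ord0) !big_ord_recl !big_ord0 /cofactor !det_mx11 !mxE /=.
by rewrite !AE /= /bump /=; ring.
Qed.

Definition bil S x y : R := (x^T *m S *m y) 0 0.

Lemma mulmx3 M x (i : 'I_3) : (M *m x) i 0 = M i 0 * x 0 0 + M i 1 * x 1 0 + M i 2 * x 2 0.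
Proof. by rewrite mxE sum_ord3. Qed.

Lemma bilE S x y : bil S x y =
  x 0 0 * (S 0 0 * y 0 0 + S 0 1 * y 1 0 + S 0 2 * y 2 0) +
  x 1 0 * (S 1 0 * y 0 0 + S 1 1 * y 1 0 + S 1 2 * y 2 0) +
  x 2 0 * (S 2 0 * y 0 0 + S 2 1 * y 1 0 + S 2 2 * y 2 0).
Proof. by rewrite /bil -mulmxA mxE sum_ord3 !mulmx3 !mxE. Qed.

Lemma sym_entry S i j : S^T = S -> S i j = S j i.
Proof. by move=> {1}<-; rewrite mxE. Qed.

Lemma bil_ext S T : (forall x y, bil S x y = bil T x y) -> S = T.
Proof.
move=> h; apply/matrixP => i j; have := h (delta_mx i 0) (delta_mx j 0).
by rewrite /bil !trmx_delta -!rowE -!colE !mxE.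
Qed.

Lemma bil_eq0 S y : (forall x, bil S x y = 0) -> S *m y = 0.
Proof.
move=> h; apply/matrixP => i j; have := h (delta_mx i 0).
by rewrite /bil trmx_delta -mulmxA -rowE !mxE (ord1 j).
Qed.

Lemma bil_change S M x y : bil (M^T *m S *m M) x y = bil S (M *m x) (M *m y).
Proof. by rewrite /bil trmx_mul !mulmxA. Qed.

Definition is_gram S (F : 'cV[R]_3 -> R) := S^T = S /\ forall x, F x = bil S x x.

Lemma quadratic_form_gram F : quadratic_form F -> exists S, is_gram S F.
Proof.
move=> [A FA]; exists (2^-1 *: (A + A^T)); split.
  by rewrite linearZ/= linearD/= trmxK addrC.
by move=> x; rewrite FA -[LHS]/(bil A x x) !bilE !mxE; field.
Qed.

Lemma gram_change S F M : is_gram S F -> is_gram (M^T *m S *m M) (fun x => F (M *m x)).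
Proof.
move=> [sS FS]; split; first by rewrite !trmx_mul trmxK sS mulmxA.
by move=> x; rewrite FS bil_change.
Qed.

Lemma gram_comb S T F G (a b : R) : is_gram S F -> is_gram T G ->
  is_gram (a *: S + b *: T) (fun x => a * F x + b * G x).
Proof.
move=> [sS FS] [sT GT]; split; first by rewrite linearD/= !linearZ/= sS sT.
by move=> x; rewrite FS GT !bilE !mxE; ring.
Qed.

Lemma gram_polar S F x y : is_gram S F -> polar F x y = bil S x y.
Proof.
move=> [sS FS]; rewrite /polar !FS !bilE !mxE.
rewrite (sym_entry 1 0 sS) (sym_entry 2 0 sS) (sym_entry 2 1 sS).
by field.
Qed.

(** The difference quotient at h is 2 bil S v x + h bil S v v. *)
Lemma derive_gram S F v x : is_gram S F -> 'D_v F x = 2 * bil S v x.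
Proof.
move=> [sS FS].
apply/cvg_lim => //.
have lim : (fun h : R => 2 * bil S v x + h * bil S v v) @ 0^' --> 2 * bil S v x.
  rewrite -[X in _ --> X]addr0 -[X in _ --> _ + X](mul0r (bil S v v)).
  apply: cvgD; first exact: cvg_cst.
  apply: cvgM; last exact: cvg_cst.
  by apply: cvg_within_filter; exact: cvg_id.
apply: cvg_trans lim; apply: near_eq_cvg; near=> h.
have h0 : h != 0 by near: h; exact: nbhs_dnbhs_neq.
rewrite /GRing.scale/= !FS !bilE !mxE /=.
rewrite (sym_entry 1 0 sS) (sym_entry 2 0 sS) (sym_entry 2 1 sS).
by field.
Unshelve. all: by end_near. Qed.

Lemma grad_gram S F x : is_gram S F -> grad F x = 2 *: (S *m x).
Proof.
move=> FS; apply/matrixP => i j; rewrite [LHS]mxE [RHS]mxE (derive_gram _ _ FS).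
by rewrite /bil /basis_vec trmx_delta -mulmxA -rowE (ord1 j) [in LHS]mxE.
Qed.

Lemma hessian_gram S F x : is_gram S F -> hessian F x = 2 *: S.
Proof.
move=> FS; apply/matrixP => i j; rewrite !mxE.
rewrite (_ : 'D_(basis_vec j) F = fun x => 2 * bil S (basis_vec j) x); last first.
  by apply/funext => y; exact: derive_gram FS.
apply/cvg_lim => //.
apply: (@cvg_trans _ ((fun=> 2 * S i j) @ (0 : R)^')); last exact: cvg_cst.
apply: near_eq_cvg; near=> h.
have h0 : h != 0 by near: h; exact: nbhs_dnbhs_neq.
rewrite /GRing.scale/=.
have -> : bil S (basis_vec j) (h *: basis_vec i + x) =
    h * bil S (basis_vec j) (basis_vec i) + bil S (basis_vec j) x.
  by rewrite !bilE !mxE /=; ring.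
have -> : bil S (basis_vec j) (basis_vec i) = S i j.
  by rewrite /bil /basis_vec trmx_delta -rowE -colE !mxE sym_entry//; case: FS.
by field.
Unshelve. all: by end_near. Qed.

End Coordinates.

(** * Planes and ranks of restricted forms *)

Section Planes.
Context {R : realType}.
Implicit Types (A B M S T : 'M[R]_3) (x y v w u : 'cV[R]_3) (H : {vspace 'cV[R]_3}).

Lemma unitmx_kernel n (M : 'M[R]_n) : (forall v : 'cV_n, M *m v = 0 -> v = 0) -> M \in unitmx.
Proof.
move=> h; rewrite -unitmx_tr unitmxE unitfE; apply/det0P => -[v v0 vM].
have := h v^T; rewrite -[M]trmxK -trmx_mul vM trmx0 => /(_ erefl) /eqP.
by rewrite trmx_eq0 (negPf v0).
Qed.

Lemma singular_kernel A : \det A = 0 -> exists2 v : 'cV[R]_3, v != 0 & A *m v = 0.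
Proof.
move=> A0; have /det0P[v v0 vA] : \det A^T == 0 by rewrite det_tr A0.
exists v^T; first by rewrite trmx_eq0.
by apply/trmx_inj; rewrite trmx_mul trmxK vA trmx0.
Qed.

(** For a nonzero column v the Gaussian factorization v = L *m pid_mx 1 *m U has a
    one by one unit U, so a multiple of L does the job. *)
Lemma complete_vector v : v != 0 -> exists2 M : 'M[R]_3, M \in unitmx & M *m delta_mx 0 0 = v.
Proof.
move=> v0; have r1 : \rank v = 1%N.
  apply/eqP; rewrite eqn_leq rank_leq_col lt0n mxrank_eq0 v0 //.
exists ((row_ebase v 0 0) *: col_ebase v).
  rewrite unitmxZ ?col_ebase_unit// unitfE.
  by have := row_ebase_unit v; rewrite unitmxE det_mx11 unitfE.
rewrite -[RHS]mulmx_ebase r1 -scalemxAl [row_ebase v]mx11_scalar mul_mx_scalar !mxE.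
congr (_ *: (_ *m _)); apply/matrixP => i j.
by rewrite !mxE (ord1 j); case: i => [[|[|[|]]]].
Qed.

Lemma free2P (vT : vectType R) (u v : vT) :
  reflect (forall a b : R, a *: u + b *: v = 0 -> a = 0 /\ b = 0) (free [:: u; v]).
Proof.
apply: (iffP (@freeP _ _ 2 [tuple u; v])) => [h a b e|h k].
  pose k := fun i : 'I_2 => if i == 0 then a else b.
  have := h k; rewrite !big_ord_recl big_ord0 /= addr0 => /(_ e) h'.
  by have := h' 0; have := h' 1.
rewrite !big_ord_recl big_ord0 /= addr0 => /h[h0 h1] i.
by case: i => [[|[|]]//= hi]; [rewrite -[RHS]h0|rewrite -[RHS]h1]; congr k; apply: val_inj.
Qed.

(** The last two columns of M are the chosen basis of H, so that the lower right
    two by two block of M^T *m S *m M is the matrix whose rank is [rank_on]. *)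
Lemma plane_basis H : \dim H = 2%N ->
  exists2 M : 'M[R]_3, M \in unitmx &
    (M *m basis_vec 1 = (vbasis H)`_0) /\ (M *m basis_vec 2 = (vbasis H)`_1).
Proof.
move=> d2; set b0 := (vbasis H)`_0; set b1 := (vbasis H)`_1.
have sz : size (vbasis H) = 2%N by rewrite size_tuple.
have vE : vbasis H = [:: b0; b1] :> seq _.
  rewrite /b0 /b1; move: sz; case: (tval (vbasis H)) => [|p [|q [|]]]//.
have /free2P fr : free [:: b0; b1] by rewrite -vE; exact: basis_free (vbasisP H).
have /subvPn[n _ nH] : ~~ (fullv <= H)%VS.
  by apply/negP => /dimvS; rewrite dimvf d2 dim_matrix.
have bH0 : b0 \in H by apply: vbasis_mem; apply: mem_nth; rewrite sz.
have bH1 : b1 \in H by apply: vbasis_mem; apply: mem_nth; rewrite sz.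
pose M := \matrix_(i < 3, j < 3) (if j == 0 then n i 0 else if j == 1 then b0 i 0 else b1 i 0) : 'M[R]_3.
have ME v : M *m v = v 0 0 *: n + v 1 0 *: b0 + v 2 0 *: b1.
  by apply/matrixP => i j; rewrite (ord1 j) mulmx3 !mxE /=; ring.
exists M; last first.
  split; rewrite ME !mxE /=; last by rewrite !scale0r !add0r scale1r.
  by rewrite !scale0r add0r addr0 scale1r.
apply: unitmx_kernel => v; rewrite ME => e.
have v0 : v 0 0 = 0.
  apply/eqP; apply: contraNT nH => v0.
  have -> : n = (v 0 0)^-1 *: (- (v 1 0 *: b0 + v 2 0 *: b1)).
    by rewrite -[LHS]scale1r -(mulVf v0) -scalerA; congr (_ *: _); apply/eqP; rewrite -addr_eq0 addrA e.
  by rewrite memvZ// memvN memvD// memvZ.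
move: e; rewrite v0 scale0r add0r => /fr[v1 v2].
apply/matrixP => i j; rewrite (ord1 j) [RHS]mxE; exact: (@forall_ord3 (fun i => v i 0 = 0)).
Qed.

Lemma plane_of_basis M : M \in unitmx ->
  exists2 H, \dim H = 2%N & forall b, b \in H ->
    exists s t : R, b = s *: (M *m basis_vec 1) + t *: (M *m basis_vec 2).
Proof.
move=> uM; exists (<<[:: M *m basis_vec 1; M *m basis_vec 2]>>%VS).
  apply/eqP; rewrite -[_ == _]/(free _); apply/free2P => a b.
  rewrite !scalemxAr -mulmxDr => /(congr1 (mulmx (invmx M))).
  rewrite mulmx0 mulKmx// => /matrixP e.
  by have := e 1 0; have := e 2 0; rewrite !mxE /= !mulr0 !mulr1 addr0 add0r.
move=> b; rewrite span_cons span_seq1 => /memv_addP[u /vlineP[s ->] [v /vlineP[t ->] ->]].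
by exists s, t.
Qed.

Definition lower_zero S : Prop := [/\ S 1 1 = 0, S 1 2 = 0 & S 2 2 = 0].

Definition lower_det S : R := S 1 1 * S 2 2 - S 1 2 ^+ 2.

(** The size of the matrix defining [rank_on] is \dim H, which is only
    propositionally equal to 2; stating the facts for every n equal to 2 allows
    the substitution. *)
Lemma rank_gram2 (g : nat -> nat -> R) n : n = 2%N ->
  let G := \matrix_(i < n, j < n) g i j in
  [/\ (\rank G <= 2)%N, (\rank G <= 1)%N <-> g 0 0 * g 1 1 - g 0 1 * g 1 0 = 0 &
      \rank G = 0%N -> forall i j, (i < 2)%N -> (j < 2)%N -> g i j = 0].
Proof.
move=> ->; move=> G; split; first exact: rank_leq_row.
  have -> : g 0 0 * g 1 1 - g 0 1 * g 1 0 = \det G.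
    by rewrite (expand_det_row _ 0) !big_ord_recl big_ord0 /cofactor !det_mx11 !mxE /= /bump /=; ring.
  rewrite -ltnS ltn_neqAle rank_leq_row andbT.
  rewrite -[_ == _]/(row_free G) row_free_unit unitmxE unitfE negbK.
  by split => /eqP.
move=> /eqP; rewrite mxrank_eq0 => /eqP/matrixP G0 i j i2 j2.
by have := G0 (Ordinal i2) (Ordinal j2); rewrite !mxE.
Qed.

Lemma bil_basis S i j : bil S (basis_vec i) (basis_vec j) = S i j.
Proof. by rewrite /bil /basis_vec trmx_delta -rowE -colE !mxE. Qed.

Lemma bil_comb S x y (a b c d : R) :
  bil S (a *: x + b *: y) (c *: x + d *: y) =
  a * c * bil S x x + a * d * bil S x y + b * c * bil S y x + b * d * bil S y y.
Proof. by rewrite !bilE !mxE; ring. Qed.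

(** The basis of H chosen in [rank_on] need not be the one carried by M; changing it
    multiplies the determinant of the block by a square. *)
Lemma rank_on_le1 S F H M : is_gram S F -> \dim H = 2%N ->
  (forall b, b \in H -> exists s t : R, b = s *: (M *m basis_vec 1) + t *: (M *m basis_vec 2)) ->
  lower_det (M^T *m S *m M) = 0 -> (rank_on F H <= 1)%N.
Proof.
move=> FS d2 hH ld.
have [_ /iffRL h _] := rank_gram2 (fun i j => polar F (vbasis H)`_i (vbasis H)`_j) d2.
apply: h.
have sz : size (vbasis H) = 2%N by rewrite size_tuple.
have [s0 [t0 ->]] : exists s t : R, (vbasis H)`_0 = s *: (M *m basis_vec 1) + t *: (M *m basis_vec 2).
  by apply: hH; apply: vbasis_mem; apply: mem_nth; rewrite sz.
have [s1 [t1 ->]] : exists s t : R, (vbasis H)`_1 = s *: (M *m basis_vec 1) + t *: (M *m basis_vec 2).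
  by apply: hH; apply: vbasis_mem; apply: mem_nth; rewrite sz.
rewrite !(gram_polar _ _ FS) !bil_comb -!bil_change !bil_basis.
have sS : (M^T *m S *m M)^T = M^T *m S *m M by case: (gram_change M FS).
move: ld; rewrite /lower_det (sym_entry 2 1 sS).
set g11 := (_ *m _) 1 1; set g12 := (_ *m _) 1 2; set g22 := (_ *m _) 2 2 => ld.
transitivity ((s0 * t1 - s1 * t0) ^+ 2 * (g11 * g22 - g12 ^+ 2)); first by ring.
by rewrite ld mulr0.
Qed.

Lemma rank_on_basis S F H M : is_gram S F -> \dim H = 2%N ->
  M *m basis_vec 1 = (vbasis H)`_0 -> M *m basis_vec 2 = (vbasis H)`_1 ->
  let G := M^T *m S *m M in
  ((rank_on F H <= 1)%N -> lower_det G = 0) /\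
  (rank_on F H = 0%N <-> lower_zero G).
Proof.
move=> FS d2 M1 M2 G.
have [_ /iffLR h1 h0] := rank_gram2 (fun i j => polar F (vbasis H)`_i (vbasis H)`_j) d2.
have sS : G^T = G by case: (gram_change M FS).
have GE : [/\ polar F (vbasis H)`_0 (vbasis H)`_0 = G 1 1,
  polar F (vbasis H)`_0 (vbasis H)`_1 = G 1 2,
  polar F (vbasis H)`_1 (vbasis H)`_0 = G 1 2 &
  polar F (vbasis H)`_1 (vbasis H)`_1 = G 2 2].
  by rewrite !(gram_polar _ _ FS) -M1 -M2 -!bil_change !bil_basis (sym_entry 2 1 sS).
case: GE => g00 g01 g10 g11; split.
  by move=> /h1; rewrite g00 g01 g10 g11 /lower_det expr2.
split=> [/h0 h|[z1 z2 z3]].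
  by split; [rewrite -g00|rewrite -g01|rewrite -g11]; exact: h.
apply/eqP; rewrite mxrank_eq0; apply/eqP/matrixP => i j; rewrite !mxE.
have i2 : (i < 2)%N := leq_trans (ltn_ord i) (eq_leq d2).
have j2 : (j < 2)%N := leq_trans (ltn_ord j) (eq_leq d2).
move: i2 j2; case: (nat_of_ord i) (nat_of_ord j) => [|[|//]] [|[|//]] _ _; by rewrite ?g00 ?g01 ?g10 ?g11.
Qed.

Lemma rank_on_le2 F H : \dim H = 2%N -> (rank_on F H <= 2)%N.
Proof. by move=> d2; exact: leq_trans (rank_leq_row _) (eq_leq d2). Qed.

Lemma bounded_max (p : nat -> Prop) b : (exists k, p k) -> (forall k, p k -> (k <= b)%N) ->
  exists m, is_max p m.
Proof.
move=> [k pk] pb; have ex : exists k, `[< p k >] by exists k; apply/asboolP.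
have pb' k' : `[< p k' >] -> (k' <= b)%N by move/asboolP/pb.
case: (ex_maxnP ex pb') => m /asboolP pm max_m; exists m; split => // k' pk'.
by apply: max_m; apply/asboolP.
Qed.

Variables (A B : 'M[R]_3) (P Q : 'cV[R]_3 -> R).
Hypotheses (gA : is_gram A P) (gB : is_gram B Q).

(** All members of the pencil have rank at most one on the plane spanned by the
    last two columns of M. *)
Definition flat_plane (A B : 'M[R]_3) := exists2 M : 'M[R]_3, M \in unitmx &
  forall a b : R, lower_det (M^T *m (a *: A + b *: B) *m M) = 0.

Lemma max_rank_exists H : \dim H = 2%N -> exists m, is_max_rank_on P Q H m.
Proof.
move=> d2; apply: (@bounded_max _ 2).
  by exists (rank_on (fun x => 0 * P x + 0 * Q x) H), 0, 0.
by move=> k [l1 [l2 ->]]; exact: rank_on_le2.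
Qed.

(** One matrix M serves all members of the pencil at once. *)
Lemma adapted_basis_of_rank_le1 H : \dim H = 2%N ->
  (forall l1 l2 : R, (rank_on (fun x => l1 * P x + l2 * Q x)%R H <= 1)%N) ->
  exists2 M : 'M[R]_3, M \in unitmx &
  (forall a b : R, lower_det (M^T *m (a *: A + b *: B) *m M) = 0) /\
  (forall a b : R, rank_on (fun x => a * P x + b * Q x) H = 0%N <->
    lower_zero (M^T *m (a *: A + b *: B) *m M)).
Proof.
move=> d2 le1; have [M uM [M1 M2]] := plane_basis d2; exists M => //.
by split=> a b; have [h1 h0] := rank_on_basis (gram_comb a b gA gB) d2 M1 M2; [exact: h1|].
Qed.

Lemma condR2P : condR 2 P Q <-> ~ flat_plane A B.
Proof.
split=> [[_ min2] [M uM ld]|nf].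
  have [H d2 hH] := plane_of_basis uM.
  have [m hm] := max_rank_exists d2.
  have m1 : (m <= 1)%N.
    have [[l1 [l2 ->]] _] := hm.
    exact: rank_on_le1 (gram_comb l1 l2 gA gB) d2 hH (ld l1 l2).
  by have := leq_trans (min2 m (ex_intro _ H (conj d2 hm))) m1.
have ge2 H m : \dim H = 2%N -> is_max_rank_on P Q H m -> (2 <= m)%N.
  move=> d2 [_ hm]; rewrite ltnNge; apply/negP => m1; apply: nf.
  have [|M uM [ld _]] := adapted_basis_of_rank_le1 d2; last by exists M.
  by move=> l1 l2; apply: leq_trans m1; apply: hm; exists l1, l2.
split; last by move=> m [H [d2 hm]]; exact: ge2 hm.
have [H d2 _] := plane_of_basis (unitmx1 R 3).
have [m hm] := max_rank_exists d2; exists H; split => //.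
have m2 := ge2 _ _ d2 hm; suff <- : m = 2%N by [].
apply/eqP; rewrite eqn_leq m2 andbT; have [[l1 [l2 ->]] _] := hm.
exact: rank_on_le2.
Qed.

Lemma condR1_flat : condR 1 P Q -> exists2 M : 'M[R]_3, M \in unitmx &
  (forall a b : R, lower_det (M^T *m (a *: A + b *: B) *m M) = 0) /\
  exists a b : R, ~ lower_zero (M^T *m (a *: A + b *: B) *m M).
Proof.
move=> [[H [d2 [[l1 [l2 e1]] max1]]] _].
have [|M uM [ld r0]] := adapted_basis_of_rank_le1 d2.
  by move=> a b; apply: max1; exists a, b.
by exists M => //; split => //; exists l1, l2 => h; have := iffRL (r0 l1 l2) h; rewrite -e1.
Qed.

Lemma condR0_flat : condR 0 P Q -> exists2 M : 'M[R]_3, M \in unitmx &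
  forall a b : R, lower_zero (M^T *m (a *: A + b *: B) *m M).
Proof.
move=> [[H [d2 [_ max0]]] _].
have rk a b : (rank_on (fun x => a * P x + b * Q x)%R H <= 0)%N.
  by apply: max0; exists a, b.
have [|M uM [_ r0]] := adapted_basis_of_rank_le1 d2.
  by move=> a b; apply: leq_trans (rk a b) _.
exists M => // a b; apply: (iffLR (r0 a b)); apply/eqP; rewrite -leqn0; exact: rk.
Qed.

End Planes.

(** * Irreducible pairs and members of rank one *)

Section Pencils.
Context {R : realType}.
Implicit Types (A B M N S T : 'M[R]_3) (x y v w u : 'cV[R]_3).

(** For symmetric matrices, the second half of irreducibility: a common kernel
    vector is a direction on which neither form depends. *)
Definition no_common_kernel A B := forall v : 'cV[R]_3, A *m v = 0 -> B *m v = 0 -> v = 0.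

Definition rank1_member A B := exists (a b k : R) (u : 'cV[R]_3),
  (a != 0 \/ b != 0) /\ a *: A + b *: B = k *: (u *m u^T).

Lemma irreducible_indep A B P Q : is_gram A P -> is_gram B Q -> irreducible_pair P Q ->
  forall a b : R, a *: A + b *: B = 0 -> a = 0 /\ b = 0.
Proof.
move=> gA gB [li _] a b e; apply: li => x.
by have [_ ->] := gram_comb a b gA gB; rewrite e /bil mulmx0 mul0mx mxE.
Qed.

Lemma gram_omits S F M v : is_gram S F -> S *m v = 0 -> M *m delta_mx 0 0 = v ->
  omits_variable (fun x => F (M *m x)) 0.
Proof.
move=> gS Sv Mv x y xy; have [sG GE] := gram_change M gS.
have c0 i : (M^T *m S *m M) i 0 = 0.
  by rewrite -[LHS](@bil_basis R) bil_change /basis_vec Mv /bil -!mulmxA Sv !mulmx0 mxE.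
rewrite !GE !bilE -(xy 1)// -(xy 2)// !c0.
rewrite (sym_entry 0 1 sG) (sym_entry 0 2 sG) !c0; ring.
Qed.

Lemma irreducible_kernel A B P Q : is_gram A P -> is_gram B Q -> irreducible_pair P Q ->
  no_common_kernel A B.
Proof.
move=> gA gB [_ nex] v Av Bv; apply/eqP; apply: contra_notT nex => v0.
have [M uM Mv] := complete_vector v0; exists M; split=> //; exists 0.
by split; [exact: gram_omits gA Av Mv|exact: gram_omits gB Bv Mv].
Qed.

Lemma gram_translate S F v : is_gram S F -> (forall y, F (y + v) = F y) -> S *m v = 0.
Proof.
move=> gS inv; apply: bil_eq0 => x.
have F0 : F 0 = 0 by have [_ ->] := gS; rewrite bilE !mxE; ring.
have Fv : F v = 0 by rewrite -[v]add0r inv.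
by rewrite -(gram_polar _ _ gS) /polar inv Fv subrr subr0 mul0r.
Qed.

(** The matrix N of the three linear forms is not assumed invertible: if N v = 0
    then P and Q are both invariant under translation by M v, which is therefore
    a common kernel vector. *)
Lemma equivalent_of_forms A B P Q P' Q' M N (a b c d : R) :
  is_gram A P -> is_gram B Q -> no_common_kernel A B ->
  M \in unitmx -> a * d - b * c != 0 ->
  (forall z, P' (N *m z) = a * P (M *m z) + b * Q (M *m z)) ->
  (forall z, Q' (N *m z) = c * P (M *m z) + d * Q (M *m z)) ->
  equivalent_pair P Q P' Q'.
Proof.
move=> gA gB nk uM D0 hP hQ.
have PE z : P (M *m z) = (d * P' (N *m z) - b * Q' (N *m z)) / (a * d - b * c).
  by rewrite hP hQ; field.
have QE z : Q (M *m z) = (a * Q' (N *m z) - c * P' (N *m z)) / (a * d - b * c).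
  by rewrite hP hQ; field.
have uN : N \in unitmx.
  apply: unitmx_kernel => v Nv.
  have zE y : y = M *m (invmx M *m y) by rewrite mulKVmx.
  have shift y : y + M *m v = M *m (invmx M *m y + v) by rewrite mulmxDr mulKVmx.
  have Mv0 : M *m v = 0.
    apply: nk.
      by apply: (gram_translate gA) => y; rewrite shift {2}[y]zE !PE mulmxDr Nv addr0.
    by apply: (gram_translate gB) => y; rewrite shift {2}[y]zE !QE mulmxDr Nv addr0.
  by rewrite -(mulKmx uM v) Mv0 mulmx0.
exists (M *m invmx N), (\matrix_(i, j) (if i == 0 then if j == 0 then a else b
   else if j == 0 then c else d)).
split.
- by rewrite unitmx_mul uM unitmx_inv.
- rewrite unitmxE unitfE (expand_det_row _ 0) !big_ord_recl big_ord0 /cofactor.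
  by rewrite !det_mx11 !mxE /= expr0 expr1 mul1r mulN1r addr0 mulrN.
- move=> x; apply/matrixP => i j; rewrite (ord1 j) !mxE !big_ord_recl big_ord0 !mxE /=.
  rewrite addr0 -mulmxA -{1 2}(mulKVmx uN x) hP hQ.
  by case: ifP.
Qed.

Lemma scale_entry (k : R) v i : (k *: v) i 0 = k * v i 0.
Proof. by rewrite mxE. Qed.

Lemma comb_entry (a b : R) A B i j : (a *: A + b *: B) i j = a * A i j + b * B i j.
Proof. by rewrite !mxE. Qed.

Lemma row_mx3E x y w i : let C := row_mx (row_mx x y) w : 'M[R]_3 in
  [/\ C i 0 = x i 0, C i 1 = y i 0 & C i 2 = w i 0].
Proof.
move=> C; split.
- transitivity (C i (lshift 1 (lshift 1 (0 : 'I_1)) : 'I_(1 + 1 + 1))); first by congr (C i _); apply: val_inj.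
  exact: etrans (@row_mxEl _ _ _ _ (row_mx x y) w i _) (@row_mxEl _ _ _ _ x y i _).
- transitivity (C i (lshift 1 (rshift 1 (0 : 'I_1)) : 'I_(1 + 1 + 1))); first by congr (C i _); apply: val_inj.
  exact: etrans (@row_mxEl _ _ _ _ (row_mx x y) w i _) (@row_mxEr _ _ _ _ x y i _).
- transitivity (C i (rshift (1 + 1) (0 : 'I_1) : 'I_(1 + 1 + 1))); first by congr (C i _); apply: val_inj.
  exact: (@row_mxEr _ _ _ _ (row_mx x y) w i _).
Qed.

Definition det_cols x y w : R := \det (row_mx (row_mx x y) w : 'M[R]_3).

Lemma det_colsE x y w : det_cols x y w =
  x 0 0 * (y 1 0 * w 2 0 - w 1 0 * y 2 0) - y 0 0 * (x 1 0 * w 2 0 - w 1 0 * x 2 0)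
  + w 0 0 * (x 1 0 * y 2 0 - y 1 0 * x 2 0).
Proof.
by rewrite /det_cols det_mx3; case: (row_mx3E x y w 0) (row_mx3E x y w 1) (row_mx3E x y w 2)
  => -> -> -> [-> -> ->] [-> -> ->].
Qed.

Lemma condD_gram A B P Q : is_gram A P -> is_gram B Q ->
  condD P Q <-> forall w, w != 0 -> ~ forall x, det_cols (A *m x) (B *m x) w = 0.
Proof.
move=> gA gB.
have e x w : \det (row_mx (row_mx (grad P x) (grad Q x)) w : 'M[R]_3) =
    4 * det_cols (A *m x) (B *m x) w.
  rewrite -/(det_cols _ _ _) (grad_gram _ gA) (grad_gram _ gB) !det_colsE.
  by rewrite !scale_entry; ring.
split=> D w w0 h; apply: (D w w0) => x; first by rewrite e h mulr0.
by apply/eqP; have := h x; rewrite e => /eqP; rewrite mulf_eq0 pnatr_eq0.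
Qed.

Lemma det_cols_mul N x y w :
  det_cols (N *m x) (N *m y) (N *m w) = \det N * det_cols x y w.
Proof. by rewrite !det_colsE !mulmx3 det_mx3; ring. Qed.

(** The image of a member k u u^T is spanned by u, so a P + b Q has its gradient
    along u, and the three columns are dependent for w = u.  When u = 0 the two
    gradients are dependent and any w will do. *)
Lemma rank1_not_condD A B P Q : is_gram A P -> is_gram B Q -> rank1_member A B -> ~ condD P Q.
Proof.
move=> gA gB [a [b [k [u [ab e]]]]] /(condD_gram gA gB) D.
have key w x : (forall i, (k *: (u *m u^T *m x)) i 0 = 0) \/ w = u ->
    det_cols (A *m x) (B *m x) w = 0.
  move=> hw; have [s hs] : exists s : R, forall i, a * (A *m x) i 0 + b * (B *m x) i 0 = s * w i 0.
    have eq i : a * (A *m x) i 0 + b * (B *m x) i 0 = (k *: (u *m u^T *m x)) i 0.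
      have := congr1 (fun S => (S *m x) i 0) e; rewrite mulmxDl -!scalemxAl.
      by rewrite [LHS]mxE !scale_entry => ->.
    case: hw => [h0|->]; first by exists 0 => i; rewrite eq h0 mul0r.
    have [t ut] : exists t : R, u^T *m x = t%:M.
      by exists ((u^T *m x) 0 0); exact: mx11_scalar.
    exists (k * t) => i.
    by rewrite eq -mulmxA ut mul_mx_scalar scalerA scale_entry.
  rewrite det_colsE; case: ab => n0.
    have h i : (A *m x) i 0 = (s * w i 0 - b * (B *m x) i 0) / a by rewrite -hs; field.
    by rewrite !h; field.
  have h i : (B *m x) i 0 = (s * w i 0 - a * (A *m x) i 0) / b by rewrite -hs; field.
  by rewrite !h; field.
have [u0|u0] := eqVneq u 0.
  have d0 : (delta_mx 0 0 : 'cV[R]_3) != 0.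
    by apply/eqP => /matrixP/(_ 0 0)/eqP; rewrite !mxE /= oner_eq0.
  apply: (D _ d0) => x; apply: key; left => i.
  by rewrite u0 mul0mx mul0mx scaler0 mxE.
by apply: (D _ u0) => x; apply: key; right.
Qed.

(** The 2 by I matrices a and b have columns a(i), b(i) in the plane, and the
    hypothesis says that a(x) and b(x) are parallel for every combination x of
    the columns.  If two columns of a are independent, b is a multiple of a.
    If all columns of a are parallel to one nonzero vector, so are those of b;
    the only case left is a = 0. *)
Lemma proportional_pairs (I : finType) (a1 a2 b1 b2 : I -> R) :
  (forall i j, a1 i * b2 j + a1 j * b2 i = a2 i * b1 j + a2 j * b1 i) ->
  (exists a b : R, (a != 0 \/ b != 0) /\
     forall i, a * a1 i + b * b1 i = 0 /\ a * a2 i + b * b2 i = 0) \/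
  (exists c d : R, (c != 0 \/ d != 0) /\
     forall i, c * a1 i + d * a2 i = 0 /\ c * b1 i + d * b2 i = 0).
Proof.
move=> h.
have h2 i : a1 i * b2 i = a2 i * b1 i by have := h i i; lra.
have scale i : a1 i != 0 \/ a2 i != 0 ->
    exists l, b1 i = l * a1 i /\ b2 i = l * a2 i.
  move=> [n0|n0].
    exists (b1 i / a1 i); split; first by field.
    have -> : b2 i = (a1 i * b2 i) / a1 i by field.
    by rewrite h2; field.
  exists (b2 i / a2 i); split; last by field.
  have -> : b1 i = (a2 i * b1 i) / a2 i by field.
  by rewrite -h2; field.
have [/existsP[i /existsP[j ij]]|] :=
    boolP [exists i, [exists j, a1 i * a2 j - a1 j * a2 i != 0]].
  have ni : a1 i != 0 \/ a2 i != 0.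
    have [z1|] := eqVneq (a1 i) 0; last by left.
    right; apply: contraNneq ij => z2; by rewrite z1 z2 mul0r mulr0 subrr.
  have nj : a1 j != 0 \/ a2 j != 0.
    have [z1|] := eqVneq (a1 j) 0; last by left.
    right; apply: contraNneq ij => z2; by rewrite z1 z2 mul0r mulr0 subrr.
  have [l [li1 li2]] := scale _ ni; have [m [mj1 mj2]] := scale _ nj.
  have lm : l = m.
    have := h i j; rewrite li1 li2 mj1 mj2 => e.
    apply/eqP; rewrite -subr_eq0; have : (l - m) * (a1 i * a2 j - a1 j * a2 i) = 0.
      by lra.
    by move/eqP; rewrite mulf_eq0 (negPf ij) orbF.
  left; exists l, (-1); split; first by right; rewrite oppr_eq0 oner_eq0.
  move=> k; have hi := h i k; have hj := h j k.
  rewrite li1 li2 in hi; rewrite mj1 mj2 -lm in hj.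
  (* the difference (x, y) of l a(k) and b(k) is parallel to both of the
     independent vectors a(i) and a(j), hence zero *)
  pose D := a1 i * a2 j - a1 j * a2 i.
  pose x := l * a1 k - b1 k; pose y := l * a2 k - b2 k.
  have e1 : a1 i * y = a2 i * x by rewrite /x /y; lra.
  have e2 : a1 j * y = a2 j * x by rewrite /x /y; lra.
  have Dx : D * x = 0.
    by rewrite /D mulrBl -!mulrA -e2 -e1 mulrCA subrr.
  have Dy : D * y = 0.
    rewrite /D mulrBl (mulrAC (a1 i)) e1 (mulrAC (a1 j)) e2; ring.
  move: Dx Dy => /eqP + /eqP; rewrite !mulf_eq0 (negPf ij) /= => /eqP x0 /eqP y0.
  by move: x0 y0; rewrite /x /y !mulN1r.
rewrite negb_exists => /forallP hpar.
have par i j : a1 i * a2 j = a1 j * a2 i.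
  by have := hpar i; rewrite negb_exists => /forallP/(_ j); rewrite negbK subr_eq0 => /eqP.
have [/existsP[i ni]|] := boolP [exists i, (a1 i != 0) || (a2 i != 0)].
  right; exists (a2 i), (- a1 i); split.
    by case/orP: ni => n0; [right; rewrite oppr_eq0|left].
  move=> j; split; first by have := par i j; lra.
  have [l [l1 l2]] := scale i (elimT orP ni).
  have := h i j; rewrite l1 l2 => e.
  by have := congr1 ( *%R l) (par i j); lra.
rewrite negb_exists => /forallP z; left; exists 1, 0; split; first by left; rewrite oner_eq0.
move=> i; have := z i; rewrite negb_or !negbK => /andP[/eqP -> /eqP ->].
by rewrite !mulr0 !mul0r addr0.
Qed.

(** In coordinates where w is the first basis vector, the condition compares the
    last two rows of the two matrices, to which [proportional_pairs] applies.
    Proportional rows give a combination whose image is the line of w, hence by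
    symmetry a multiple of w w^T; rows on a common line give a common left,
    hence right, kernel vector. *)
Lemma not_condD_rank1 A B P Q : is_gram A P -> is_gram B Q -> no_common_kernel A B ->
  ~ condD P Q -> rank1_member A B.
Proof.
move=> gA gB nk nD; have [sA _] := gA; have [sB _] := gB.
have [w w0 hw] : exists2 w : 'cV[R]_3, w != 0 & forall x, det_cols (A *m x) (B *m x) w = 0.
  apply: contra_notP nD => h; apply/(condD_gram gA gB) => w w0 hw; apply: h.
  by exists w.
have [M uM Mw] := complete_vector w0; pose N := invmx M.
have Nw : N *m w = delta_mx 0 0 by rewrite /N -Mw mulKmx.
pose phi x y := (N *m A *m x) 1 0 * (N *m B *m y) 2 0 - (N *m A *m x) 2 0 * (N *m B *m y) 1 0.
have phi0 x : phi x x = 0.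
  have : \det N * det_cols (A *m x) (B *m x) w = 0 by rewrite hw mulr0.
  rewrite -det_cols_mul Nw det_colsE !mulmxA => <-; rewrite /phi.
  have d0 (i : 'I_3) : (delta_mx 0 0 : 'cV[R]_3) i 0 = (i == 0)%:R by rewrite mxE andbT.
  by rewrite !d0 /=; ring.
have phiE i j : phi (basis_vec i) (basis_vec j) =
    (N *m A) 1 i * (N *m B) 2 j - (N *m A) 2 i * (N *m B) 1 j.
  by rewrite /phi /basis_vec -!colE !mxE.
have h i j : (N *m A) 1 i * (N *m B) 2 j + (N *m A) 1 j * (N *m B) 2 i =
    (N *m A) 2 i * (N *m B) 1 j + (N *m A) 2 j * (N *m B) 1 i.
  have e : phi (basis_vec i + basis_vec j) (basis_vec i + basis_vec j) =
      phi (basis_vec i) (basis_vec i) + phi (basis_vec j) (basis_vec j) +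
      (phi (basis_vec i) (basis_vec j) + phi (basis_vec j) (basis_vec i)).
    have add3 (C : 'M[R]_3) x y i' : (C *m (x + y)) i' 0 = (C *m x) i' 0 + (C *m y) i' 0.
      by rewrite mulmxDr mxE.
    by rewrite /phi !add3; ring.
  by move: e; rewrite !phi0 !phiE; lra.
case: (proportional_pairs h) => [[a [b [ab hab]]]|[c [d [cd hcd]]]].
  exists a, b; pose S := a *: A + b *: B.
  have NS1 i : (N *m S) 1 i = 0 /\ (N *m S) 2 i = 0.
    by rewrite /S mulmxDr -!scalemxAr !comb_entry.
  have SE i j : S i j = w i 0 * (N *m S) 0 j.
    rewrite -[in LHS](mulKVmx uM S) -/N -Mw -colE [LHS]mxE sum_ord3.
    by have [-> ->] := NS1 j; rewrite [in RHS]mxE !mulr0 !addr0.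
  have sS : S^T = S by rewrite /S linearD/= !linearZ/= sA sB.
  have /matrix0Pn[i [j]] := w0; rewrite (ord1 j) => wi.
  exists ((N *m S) 0 i / w i 0), w; split => //; rewrite -/S.
  have outer (u : 'cV[R]_3) k l : (u *m u^T) k l = u k 0 * u l 0.
    by rewrite mxE big_ord1 [in LHS]mxE.
  apply/matrixP => k l; rewrite [RHS]mxE outer.
  have : w i 0 * (N *m S) 0 l = w l 0 * (N *m S) 0 i by rewrite -!SE sym_entry.
  rewrite SE; move: ((N *m S) 0 l) ((N *m S) 0 i) => r r' e.
  have -> : r = w l 0 * r' / w i 0 by rewrite -e; field.
  by field.
exfalso; pose q : 'rV[R]_3 := c *: delta_mx 0 1 + d *: delta_mx 0 2.
have qE (C : 'M[R]_3) j : (q *m C) 0 j = c * C 1 j + d * C 2 j.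
  by rewrite /q mulmxDl -!scalemxAl -!rowE !mxE.
have v0 : (q *m N)^T = 0.
  apply: nk; apply/trmx_inj; rewrite trmx_mul trmxK trmx0 ?sA ?sB -mulmxA;
    apply/matrixP => i j; rewrite (ord1 i) qE [RHS]mxE; by have [] := hcd j.
have q0 : q = 0 by rewrite -[q](mulmxKV uM) -/N -[q *m N]trmxK v0 trmx0 mul0mx.
have := qE 1%:M 1; have := qE 1%:M 2; rewrite q0 mul0mx !mxE /= !mulr1 !mulr0 addr0 add0r => d0 c0.
by case: cd; rewrite -?d0 -?c0 eqxx.
Qed.

End Pencils.

(** * The determinant of the pencil *)

Section Discriminant.
Context {R : realType}.
Implicit Types (A B M N S T : 'M[R]_3) (x y v w u : 'cV[R]_3).

Lemma outer_entry u i j : (u *m u^T) i j = u i 0 * u j 0.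
Proof. by rewrite mxE big_ord1 [in LHS]mxE. Qed.

Definition pencil_det A B (s t : R) : R := \det (s *: A + t *: B).

Lemma comb_change A B M (a b : R) :
  M^T *m (a *: A + b *: B) *m M = a *: (M^T *m A *m M) + b *: (M^T *m B *m M).
Proof. by rewrite mulmxDr mulmxDl -!scalemxAr -!scalemxAl. Qed.

Lemma pencil_det_change A B M s t :
  pencil_det (M^T *m A *m M) (M^T *m B *m M) s t = \det M ^+ 2 * pencil_det A B s t.
Proof. by rewrite /pencil_det -comb_change !det_mulmx det_tr; ring. Qed.

Lemma pencil_det_cubic A B : binary_cubic (pencil_det A B).
Proof.
pose f := pencil_det A B.
exists (f 1 0), ((f 1 1 - f 1 (-1)) / 2 - f 0 1), ((f 1 1 + f 1 (-1)) / 2 - f 1 0), (f 0 1) => s t.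
by rewrite /f /pencil_det !det_mx3 !comb_entry; field.
Qed.

Lemma has_square_factor_scale (k : R) (c c' : R -> R -> R) :
  (forall s t, c s t = k * c' s t) -> has_square_factor c' -> has_square_factor c.
Proof.
move=> e [p [q [r [s h]]]]; exists p, q, (k * r), (k * s) => x y.
by rewrite e h; ring.
Qed.

Lemma has_square_factor_swap A B :
  has_square_factor (pencil_det A B) -> has_square_factor (pencil_det B A).
Proof.
move=> [p [q [r [s h]]]]; exists q, p, s, r => x y.
by rewrite /pencil_det addrC -/(pencil_det A B y x) h; ring.
Qed.

(** If A is k u u^T up to a multiple of B, then det(sA + tB) is the determinant of
    a rank one perturbation of t'B, with t' linear in (s, t), and that is
    divisible by t'^2. *)
Lemma rank1_square_factor A B : rank1_member A B -> has_square_factor (pencil_det A B).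
Proof.
have main A' B' (a b k : R) (u : 'cV[R]_3) : a != 0 ->
    a *: A' + b *: B' = k *: (u *m u^T) -> has_square_factor (pencil_det A' B').
  move=> a0 e.
  have AE i j : A' i j = (k * (u i 0 * u j 0) - b * B' i j) / a.
    have := congr1 (fun S : 'M[R]_3 => S i j) e; rewrite /= comb_entry.
    by rewrite [RHS]mxE outer_entry => h; rewrite -h; field.
  pose al := \det (u *m u^T + B') - \det B'.
  exists (- b / a), 1, (k / a * al - b / a * \det B'), (\det B') => s t.
  have uE i j : (u *m u^T + B') i j = u i 0 * u j 0 + B' i j.
    by rewrite mxE outer_entry.
  by rewrite /al /pencil_det !det_mx3 !comb_entry !uE !AE; field.
move=> [a [b [k [u [[a0|b0] e]]]]]; first exact: main a0 e.
by apply: has_square_factor_swap; apply: main b0 _; rewrite addrC; exact: e.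
Qed.

Lemma common_square_aux (a b c a' b' c' : R) :
  a * c - b ^+ 2 = 0 -> a' * c' - b' ^+ 2 = 0 ->
  a * c' + c * a' - 2 * b * b' = 0 -> a != 0 ->
  exists k k' y z : R, [/\ a = k * y ^+ 2, b = k * y * z & c = k * z ^+ 2] /\
    [/\ a' = k' * y ^+ 2, b' = k' * y * z & c' = k' * z ^+ 2].
Proof.
move=> h1 h2 h3 a0; exists a, a', 1, (b / a).
have eb : b' = a' * (b / a).
  have : (a * b' - a' * b) ^+ 2 = 0.
    transitivity (a' * a * (a * c' + c * a' - 2 * b * b') - a ^+ 2 * (a' * c' - b' ^+ 2)
       - a' ^+ 2 * (a * c - b ^+ 2)); first by ring.
    by rewrite h1 h2 h3; ring.
  move/eqP; rewrite sqrf_eq0 subr_eq0 => /eqP h.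
  by apply: (mulfI a0); rewrite h; field.
have ec : c = b ^+ 2 / a by rewrite (_ : b ^+ 2 = a * c); [field|lra].
have ec' : c' = a' * (b / a) ^+ 2.
  have -> : c' = (a * c' + c * a' - 2 * b * b' - c * a' + 2 * b * b') / a by field.
  by rewrite h3 eb ec; field.
by split; split; rewrite ?expr1n ?mulr1 ?ec//; field.
Qed.

(** The discriminant of a pencil of binary forms is a quadratic form in (s, t); its
    three coefficients vanish, which forces both forms to be multiples of one
    square. *)
Lemma common_square (a b c a' b' c' : R) :
  (forall s t, (s * a + t * a') * (s * c + t * c') - (s * b + t * b') ^+ 2 = 0) ->
  exists k k' y z : R, [/\ a = k * y ^+ 2, b = k * y * z & c = k * z ^+ 2] /\
    [/\ a' = k' * y ^+ 2, b' = k' * y * z & c' = k' * z ^+ 2].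
Proof.
move=> h.
have h1 : a * c - b ^+ 2 = 0 by have := h 1 0; rewrite !mul1r !mul0r !addr0.
have h2 : a' * c' - b' ^+ 2 = 0 by have := h 0 1; rewrite !mul1r !mul0r !add0r.
have h3 : a * c' + c * a' - 2 * b * b' = 0.
  by have := h 1 1; rewrite !mul1r => h4; lra.
have [a0|a0] := eqVneq a 0; last exact: common_square_aux.
have b0 : b = 0.
  by move: h1; rewrite a0 mul0r sub0r => /eqP; rewrite oppr_eq0 sqrf_eq0 => /eqP.
have [a0'|a0'] := eqVneq a' 0; last first.
  have h3' : a' * c + c' * a - 2 * b' * b = 0 by lra.
  have [k [k' [y [z [e1 e2]]]]] := common_square_aux h2 h1 h3' a0'.
  by exists k', k, y, z.
have b0' : b' = 0.
  by move: h2; rewrite a0' mul0r sub0r => /eqP; rewrite oppr_eq0 sqrf_eq0 => /eqP.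
by exists c, c', 0, 1; rewrite a0 b0 a0' b0'; split; split; ring.
Qed.

Lemma lower_common_square A B : (forall s t : R, lower_det (s *: A + t *: B) = 0) ->
  exists k k' y z : R, [/\ A 1 1 = k * y ^+ 2, A 1 2 = k * y * z & A 2 2 = k * z ^+ 2] /\
    [/\ B 1 1 = k' * y ^+ 2, B 1 2 = k' * y * z & B 2 2 = k' * z ^+ 2].
Proof. by move=> h; apply: common_square => s t; rewrite -(h s t) /lower_det !comb_entry. Qed.

(** With z the common vector of the lower blocks, which are multiples of z z^T, the
    determinant is minus the multiplier times the square of a 2 by 2 determinant
    of z with the off-diagonal row; both are linear in (s, t). *)
Lemma flat_square_factor A B : A^T = A -> B^T = B -> flat_plane A B ->
  has_square_factor (pencil_det A B).
Proof.
move=> sA sB [M uM ld].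
have sA' : (M^T *m A *m M)^T = M^T *m A *m M by rewrite !trmx_mul trmxK sA mulmxA.
have sB' : (M^T *m B *m M)^T = M^T *m B *m M by rewrite !trmx_mul trmxK sB mulmxA.
have [k [k' [y [z [[a11 a12 a22] [b11 b12 b22]]]]]] :
    exists k k' y z : R, _ :=
  lower_common_square (fun s t => etrans (congr1 _ (esym (comb_change A B M s t))) (ld s t)).
apply: (@has_square_factor_scale ((\det M ^+ 2)^-1) _ (pencil_det (M^T *m A *m M) (M^T *m B *m M))).
  move=> s t; rewrite pencil_det_change mulKf// sqrf_eq0.
  by move: uM; rewrite unitmxE unitfE.
move: (M^T *m A *m M) (M^T *m B *m M) sA' sB' a11 a12 a22 b11 b12 b22 => A' B' sA' sB' a11 a12 a22 b11 b12 b22.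
exists (A' 0 1 * z - A' 0 2 * y), (B' 0 1 * z - B' 0 2 * y), (- k), (- k') => s t.
rewrite /pencil_det det_mx3 !comb_entry (sym_entry 1 0 sA') (sym_entry 2 0 sA') (sym_entry 2 1 sA').
rewrite (sym_entry 1 0 sB') (sym_entry 2 0 sB') (sym_entry 2 1 sB') a11 a12 a22 b11 b12 b22.
by ring.
Qed.

Lemma kernel_change A M v : A *m v = 0 -> M *m basis_vec 0 = v -> A^T = A -> forall i,
  (M^T *m A *m M) i 0 = 0 /\ (M^T *m A *m M) 0 i = 0.
Proof.
move=> Av Mv sA.
have c0 i : (M^T *m A *m M) i 0 = 0.
  by rewrite -[LHS](@bil_basis R) bil_change Mv /bil -!mulmxA Av !mulmx0 mxE.
by move=> i; split => //; rewrite sym_entry// !trmx_mul trmxK sA mulmxA.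
Qed.

(** S is the member of the pencil at the double zero and T completes it to a basis
    of the pencil.  In a basis starting with a kernel vector v of S, the
    coefficient of s^2 t in det(sS + tT) is the value of T at v times the
    determinant of the lower block of S; it vanishes, and the two factors give
    the two alternatives. *)
Lemma square_factor_degenerate A B : A^T = A -> B^T = B -> no_common_kernel A B ->
  has_square_factor (pencil_det A B) -> rank1_member A B \/ flat_plane A B.
Proof.
move=> sA sB nk [p [q [r [r' h]]]].
(* if the squared factor p s + q t is zero then so is the cubic, and any member
   of the pencil will do *)
have [a [b [ab pq]]] : exists a b : R, (a != 0 \/ b != 0) /\ p * a + q * b = 0.
  have [q0|q0] := eqVneq q 0; last by exists q, (- p); split; [left|ring].
  by exists 0, 1; split; [right; rewrite oner_eq0|rewrite q0; ring].
have D0 : a ^+ 2 + b ^+ 2 != 0.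
  by rewrite paddr_eq0 ?sqr_ge0// !sqrf_eq0 negb_and; apply/orP.
pose S := a *: A + b *: B; pose T := (- b) *: A + a *: B.
have sS : S^T = S by rewrite /S linearD/= !linearZ/= sA sB.
have sT : T^T = T by rewrite /T linearD/= !linearZ/= sA sB.
have hST s t : pencil_det S T s t =
    t ^+ 2 * ((q * a - p * b) ^+ 2 * (r * (s * a - t * b) + r' * (s * b + t * a))).
  have -> : pencil_det S T s t = pencil_det A B (s * a - t * b) (s * b + t * a).
    by congr (\det _); apply/matrixP => i j; rewrite !comb_entry; ring.
  rewrite h (_ : p * _ + _ = s * (p * a + q * b) + t * (q * a - p * b)); last by ring.
  by rewrite pq; ring.
have [v v0 Sv] : exists2 v : 'cV[R]_3, v != 0 & S *m v = 0.
  apply: singular_kernel; have := hST 1 0; rewrite /pencil_det scale1r scale0r addr0 => ->.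
  by ring.
have [M uM Mv] := complete_vector v0.
pose S' := M^T *m S *m M; pose T' := M^T *m T *m M.
have S0 i : S' i 0 = 0 /\ S' 0 i = 0 by exact: kernel_change Sv Mv sS i.
have sS' : S'^T = S' by rewrite !trmx_mul trmxK sS mulmxA.
have sT' : T'^T = T' by rewrite !trmx_mul trmxK sT mulmxA.
have : T' 0 0 * lower_det S' = 0.
  have hST' s t := pencil_det_change S T M s t; rewrite -/S' -/T' in hST'.
  (* the second difference extracts the coefficient of s^2 t *)
  have e : pencil_det S' T' 1 1 + pencil_det S' T' (-1) 1 - 2 * pencil_det S' T' 0 1 = 0.
    by rewrite !hST' !hST; ring.
  have : pencil_det S' T' 1 1 + pencil_det S' T' (-1) 1 - 2 * pencil_det S' T' 0 1 =
      2 * (T' 0 0 * lower_det S').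
    rewrite /pencil_det !det_mx3 !comb_entry /lower_det.
    have [-> _] := S0 0; have [-> ->] := S0 1; have [-> ->] := S0 2.
    by rewrite (sym_entry 2 1 sS'); ring.
  by rewrite e => /esym/eqP; rewrite mulf_eq0 pnatr_eq0 => /eqP.
move/eqP; rewrite mulf_eq0 => /orP[/eqP T00|/eqP ld]; [right|left].
  pose g := T' 0 1; pose g' := T' 0 2.
  have gg : g != 0 \/ g' != 0.
    have [g0|] := eqVneq g 0; last by left.
    right; apply/eqP => g0'; move/eqP: v0; apply.
    have T'0 : T' *m basis_vec 0 = 0.
      apply/matrixP => i j; rewrite (ord1 j) /basis_vec -colE [LHS]mxE [RHS]mxE.
      rewrite sym_entry//; apply: (@forall_ord3 (fun i => T' 0 i = 0)) => //.
    have Tv : T *m v = 0.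
      have : M^T *m (T *m v) = 0 by rewrite -Mv -T'0 /T' /basis_vec !mulmxA.
      by move/(congr1 (mulmx (invmx M^T))); rewrite mulmx0 mulKmx// unitmx_tr.
    have e1 : A = (a ^+ 2 + b ^+ 2)^-1 *: (a *: S - b *: T).
      by apply/matrixP => i j; rewrite /S /T !mxE; field.
    have e2 : B = (a ^+ 2 + b ^+ 2)^-1 *: (b *: S + a *: T).
      by apply/matrixP => i j; rewrite /S /T !mxE; field.
    apply: nk.
      by rewrite e1 -scalemxAl mulmxBl -!scalemxAl Sv Tv !scaler0 subr0 scaler0.
    by rewrite e2 -scalemxAl mulmxDl -!scalemxAl Sv Tv !scaler0 addr0 scaler0.
  (* (0, g, g') is the row of T at v; the plane consists of v and the vector
     (g', -g), on which that row vanishes *)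
  pose Kf (i j : 'I_3) : R := (if j == 0 then if i == 1 then g else if i == 2 then g' else 0
     else if j == 1 then (i == 0)%:R else if i == 1 then g' else if i == 2 then - g else 0).
  pose K : 'M[R]_3 := \matrix_(i, j) Kf i j.
  have KE i j : K i j = Kf i j by rewrite mxE.
  have Ke i j : (K *m basis_vec j) i 0 = K i j by rewrite /basis_vec -colE mxE.
  exists (M *m K).
    rewrite unitmx_mul uM unitmxE unitfE det_mx3 !KE /Kf /=.
    rewrite (_ : _ + _ = g ^+ 2 + g' ^+ 2); last by ring.
    by rewrite paddr_eq0 ?sqr_ge0// !sqrf_eq0 negb_and; apply/orP.
  move=> s t.
  have [s' [t' ->]] : exists s' t' : R, s *: A + t *: B = s' *: S + t' *: T.
    exists ((s * a + t * b) / (a ^+ 2 + b ^+ 2)), ((t * a - s * b) / (a ^+ 2 + b ^+ 2)).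
    by apply/matrixP => i j; rewrite /S /T !mxE; field.
  have -> : (M *m K)^T *m (s' *: S + t' *: T) *m (M *m K) =
      s' *: (K^T *m S' *m K) + t' *: (K^T *m T' *m K).
    by rewrite comb_change /S' /T' !trmx_mul !mulmxA.
  have K1 i : (K^T *m S' *m K) 1 i = 0.
    rewrite -[LHS](@bil_basis R) bil_change bilE.
    have [-> _] := S0 0; have [-> ->] := S0 1; have [-> ->] := S0 2.
    by rewrite !Ke !KE /Kf /=; ring.
  have K2 : (K^T *m T' *m K) 1 1 = 0.
    rewrite -[LHS](@bil_basis R) bil_change bilE T00 !Ke !KE /Kf /=; ring.
  have K3 : (K^T *m T' *m K) 1 2 = 0.
    rewrite -[LHS](@bil_basis R) bil_change bilE T00 !Ke !KE /Kf /= -/g -/g'; ring.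
  by rewrite /lower_det !comb_entry !K1 K2 K3; ring.
have [|k [_ [y [z [[s11 s12 s22] _]]]]] := @common_square (S' 1 1) (S' 1 2) (S' 2 2) 0 0 0.
  by move=> s t; transitivity (s ^+ 2 * lower_det S'); [rewrite /lower_det; ring|rewrite ld mulr0].
pose z0 : 'cV[R]_3 := \col_i (if i == 1 then y else if i == 2 then z else 0).
have S'E : S' = k *: (z0 *m z0^T).
  apply/matrixP => i j; rewrite [RHS]mxE outer_entry ![z0 _ _]mxE.
  move: i j; apply: forall_ord3; apply: forall_ord3 => /=;
    rewrite ?(S0 _).1 ?(S0 _).2 ?s11 ?s12 ?s22 ?(sym_entry 2 1 sS') ?s12; ring.
exists a, b, k, ((invmx M)^T *m z0); split => //.
rewrite -/S trmx_mul trmxK -mulmxA (mulmxA z0) mulmxA.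
rewrite scalemxAl scalemxAr -S'E /S' !mulmxA -trmx_mul mulmxV// trmx1 mul1mx.
by rewrite -mulmxA mulmxV// mulmx1.
Qed.

End Discriminant.

(** * Normal forms *)

Section NormalForms.
Context {R : realType}.
Implicit Types (A B M N S T : 'M[R]_3) (x y v w u z : 'cV[R]_3).

Lemma gram_unique S T F : is_gram S F -> is_gram T F -> S = T.
Proof.
by move=> gS gT; apply: bil_ext => x y; rewrite -(gram_polar x y gS) -(gram_polar x y gT).
Qed.

(** The criterion to recognize a member of rank one from values in coordinates M. *)
Lemma rank1_of_square A B P Q M (a b k u0 u1 u2 : R) : is_gram A P -> is_gram B Q ->
  M \in unitmx -> a != 0 \/ b != 0 ->
  (forall z, a * P (M *m z) + b * Q (M *m z) =
     k * (u0 * xi1 z + u1 * xi2 z + u2 * xi3 z) ^+ 2) -> rank1_member A B.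
Proof.
move=> gA gB uM ab h.
pose u : 'cV[R]_3 := \col_i (if i == 0 then u0 else if i == 1 then u1 else u2).
have uE i : u i 0 = if i == 0 then u0 else if i == 1 then u1 else u2 by rewrite mxE.
have gS := gram_change M (gram_comb a b gA gB).
have gT : is_gram (k *: (u *m u^T)) (fun z => a * P (M *m z) + b * Q (M *m z)).
  split; first by rewrite linearZ/= trmx_mul trmxK.
  have TE i j : (k *: (u *m u^T)) i j = k * (u i 0 * u j 0) by rewrite mxE outer_entry.
  by move=> z; rewrite h bilE !TE !uE /= /xi1 /xi2 /xi3; ring.
exists a, b, k, ((invmx M)^T *m u); split => //.
rewrite trmx_mul trmxK -mulmxA (mulmxA u) mulmxA scalemxAl scalemxAr -(gram_unique gS gT).
by rewrite !mulmxA -trmx_mul mulmxV// trmx1 mul1mx -mulmxA mulmxV// mulmx1.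
Qed.

Definition rows3 (a b c d e f g h i : R) : 'M[R]_3 :=
  \matrix_(k, l) nth 0 (nth [::] [:: [:: a; b; c]; [:: d; e; f]; [:: g; h; i]] k) l.

Lemma rows3E a b c d e f g h i z : let N := rows3 a b c d e f g h i in
  [/\ xi1 (N *m z) = a * xi1 z + b * xi2 z + c * xi3 z,
      xi2 (N *m z) = d * xi1 z + e * xi2 z + f * xi3 z &
      xi3 (N *m z) = g * xi1 z + h * xi2 z + i * xi3 z].
Proof. by rewrite /= /xi1 /xi2 /xi3 !mulmx3 !mxE. Qed.

(** The recombination of P and Q is split in two steps, through a pair P2, Q2 given
    explicitly in the coordinates M. *)
Lemma equivalent_of_forms_comp A B P Q P2 Q2 P' Q' M N (a b c d a' b' c' d' : R) :
  is_gram A P -> is_gram B Q -> no_common_kernel A B -> M \in unitmx ->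
  a * d - b * c != 0 -> a' * d' - b' * c' != 0 ->
  (forall z, a * P (M *m z) + b * Q (M *m z) = P2 z) ->
  (forall z, c * P (M *m z) + d * Q (M *m z) = Q2 z) ->
  (forall z, P' (N *m z) = a' * P2 z + b' * Q2 z) ->
  (forall z, Q' (N *m z) = c' * P2 z + d' * Q2 z) ->
  equivalent_pair P Q P' Q'.
Proof.
move=> gA gB nk uM D D' hP hQ hP' hQ'.
apply: (@equivalent_of_forms _ A B P Q P' Q' M N (a' * a + b' * c) (a' * b + b' * d)
  (c' * a + d' * c) (c' * b + d' * d)) => // [|z|z].
- rewrite (_ : _ - _ = (a' * d' - b' * c') * (a * d - b * c)); last by ring.
  by rewrite mulf_neq0.
- by rewrite hP' -hP -hQ; ring.
- by rewrite hQ' -hP -hQ; ring.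
Qed.

Lemma signed_square (a : R) : exists (e l : R), (e = 1 \/ e = -1) /\ a = e * l ^+ 2.
Proof.
have [a0|a0] := leP 0 a.
  by exists 1, (Num.sqrt a); split; [left|rewrite mul1r sqr_sqrtr].
exists (-1), (Num.sqrt (- a)); split; [by right|].
by rewrite sqr_sqrtr ?mulN1r ?opprK// oppr_ge0 ltW.
Qed.

Lemma degenerate_binary_square (a b c : R) : a * c - b ^+ 2 = 0 ->
  exists e l m : R, (e = 1 \/ e = -1) /\
    forall y z : R, a * y ^+ 2 + 2 * b * y * z + c * z ^+ 2 = e * (l * y + m * z) ^+ 2.
Proof.
move=> D; have [a0|a0] := eqVneq a 0.
  have b0 : b = 0.
    by move: D; rewrite a0 mul0r sub0r => /eqP; rewrite oppr_eq0 sqrf_eq0 => /eqP.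
  have [e [m [he hc]]] := signed_square c.
  by exists e, 0, m; split=> // y z; rewrite a0 b0 hc; ring.
have [e [l [he ha]]] := signed_square a.
have l0 : l != 0 by apply: contraNneq a0 => l0; rewrite ha l0 expr0n mulr0.
have e2 : e ^+ 2 = 1 by case: he => ->; rewrite ?sqrrN expr1n.
exists e, l, (e * b / l); split => // y z.
have -> : c = e * b ^+ 2 / l ^+ 2.
  have : a * c = b ^+ 2 by lra.
  move=> h; apply: (mulfI a0); rewrite h ha.
  transitivity (e ^+ 2 * b ^+ 2); first by rewrite e2 mul1r.
  by field.
rewrite ha; transitivity (e * l ^+ 2 * y ^+ 2 + 2 * e ^+ 2 * b * y * z + e * (e ^+ 2) * b ^+ 2 / l ^+ 2 * z ^+ 2).
  by rewrite e2; ring.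
by field.
Qed.

(** Complete the square on a nonzero diagonal coefficient; when there is none, the
    form is a multiple of y z, a difference of two squares. *)
Lemma binary_diagonal (a b c : R) : exists e e' l m l' m' : R,
  [/\ e = 1 \/ e = -1, e' = 1 \/ e' = -1 & forall y z : R,
    a * y ^+ 2 + 2 * b * y * z + c * z ^+ 2 =
    e * (l * y + m * z) ^+ 2 + e' * (l' * y + m' * z) ^+ 2].
Proof.
have split_lead (u v : R) : u != 0 -> exists e e' l m n : R,
    [/\ e = 1 \/ e = -1, e' = 1 \/ e' = -1 & forall y z : R,
    u * y ^+ 2 + 2 * b * y * z + v * z ^+ 2 = e * (l * y + m * z) ^+ 2 + e' * (n * z) ^+ 2].
  move=> u0; have [e' [n [he' hn]]] := signed_square (v - b ^+ 2 / u).
  have D : u * (b ^+ 2 / u) - b ^+ 2 = 0 by field.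
  have [e [l [m [he h]]]] := degenerate_binary_square D.
  exists e, e', l, m, n; split => // y z; by rewrite -h exprMn [e' * _]mulrA -hn; ring.
have [a0|a0] := eqVneq a 0; last first.
  have [e [e' [l [m [n [he he' h]]]]]] := split_lead a c a0.
  by exists e, e', l, m, 0, n; split=> // y z; rewrite h; ring.
have [c0|c0] := eqVneq c 0; last first.
  have [e [e' [l [m [n [he he' h]]]]]] := split_lead c a c0.
  exists e, e', m, l, n, 0; split=> // y z.
  transitivity (c * z ^+ 2 + 2 * b * z * y + a * y ^+ 2); first by ring.
  by rewrite h; ring.
pose s : R := Num.sqrt (1 / 2); have s2 : s ^+ 2 = 1 / 2 by rewrite sqr_sqrtr//; lra.
exists 1, (-1), s, (s * b), s, (- (s * b)); split; [by left|by right|move=> y z].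
transitivity (s ^+ 2 * (4 * b * y * z)); last by ring.
by rewrite s2 a0 c0; field.
Qed.

Section Pair.
Variables (A B : 'M[R]_3) (P Q : 'cV[R]_3 -> R).
Hypotheses (gA : is_gram A P) (gB : is_gram B Q) (nk : no_common_kernel A B).
Hypothesis indep : forall a b : R, a *: A + b *: B = 0 -> a = 0 /\ b = 0.

Lemma gram_coords S F z : is_gram S F -> F z =
  S 0 0 * xi1 z ^+ 2 + S 1 1 * xi2 z ^+ 2 + S 2 2 * xi3 z ^+ 2 +
  2 * (S 0 1 * xi1 z * xi2 z + S 0 2 * xi1 z * xi3 z + S 1 2 * xi2 z * xi3 z).
Proof.
move=> [sS ->]; rewrite bilE (sym_entry 1 0 sS) (sym_entry 2 0 sS) (sym_entry 2 1 sS).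
by rewrite /xi1 /xi2 /xi3; ring.
Qed.

(** In coordinates where the rank one member is xi1^2, let C be the complementary
    member.  If the restriction of C to xi1 = 0 is degenerate, it is a signed
    square, and what remains of C is xi1 times a linear form: third normal form.
    If it is nondegenerate, a translation by multiples of xi1 absorbs the mixed
    terms, and the sign pattern of its diagonalization selects the first or the
    second normal form. *)
Lemma normal_form_rank1 : rank1_member A B ->
  [\/ equivalent_pair P Q (fun x => xi1 x ^+ 2 + xi2 x ^+ 2) (fun x => xi3 x ^+ 2),
      equivalent_pair P Q (fun x => xi1 x ^+ 2 - xi2 x ^+ 2) (fun x => xi3 x ^+ 2) |
      equivalent_pair P Q (fun x => xi1 x * xi2 x + xi3 x ^+ 2) (fun x => xi1 x ^+ 2)].
Proof.
move=> [a [b [k [u [ab e]]]]].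
have ab0 : k *: (u *m u^T) != 0.
  by apply: contraPneq ab => k0; have [|-> ->] := @indep a b; rewrite ?e// eqxx => -[].
have k0 : k != 0 by apply: contraNneq ab0 => ->; rewrite scale0r.
have u0 : u != 0 by apply: contraNneq ab0 => ->; rewrite mul0mx scaler0.
have [K uK Ku] := complete_vector u0.
pose M := (invmx K)^T.
have uM : M \in unitmx by rewrite unitmx_tr unitmx_inv.
have Mu : M^T *m u = basis_vec 0 by rewrite /M trmxK -Ku mulKmx.
have D0 : a * a - b * (- b) != 0.
  rewrite mulrN opprK -!expr2 paddr_eq0 ?sqr_ge0// !sqrf_eq0 negb_and; exact/orP.
have hP z : a * P (M *m z) + b * Q (M *m z) = k * xi1 z ^+ 2.
  have [_ h] := gram_comb a b gA gB; rewrite h e -bil_change -scalemxAr -scalemxAl.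
  have -> : M^T *m (u *m u^T) *m M = basis_vec 0 *m (basis_vec 0)^T by rewrite -Mu trmx_mul trmxK !mulmxA.
  rewrite bilE.
  have eE i j : (k *: (basis_vec 0 *m (basis_vec 0)^T : 'M[R]_3)) i j = k * ((i == 0)%:R * (j == 0)%:R).
    by rewrite mxE outer_entry /basis_vec ![(delta_mx _ _ _ _)]mxE !andbT.
  by rewrite !eE /= /xi1; ring.
have gC := gram_change M (gram_comb (- b) a gA gB).
set C := M^T *m _ *m M in gC.
have hQ z := gram_coords z gC.
set c00 := C 0 0 in hQ; set c11 := C 1 1 in hQ; set c22 := C 2 2 in hQ.
set c01 := C 0 1 in hQ; set c02 := C 0 2 in hQ; set c12 := C 1 2 in hQ.
have [Dq|Dq] := eqVneq (c11 * c22 - c12 ^+ 2) 0.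
  have [f [l [m [hf h]]]] := degenerate_binary_square Dq.
  have f2 : f * f = 1 by case: hf => ->; ring.
  apply: Or33; apply: (@equivalent_of_forms_comp A B P Q _ _ _ _ M
    (rows3 1 0 0 (f * c00) (2 * f * c01) (2 * f * c02) 0 l m) a b (- b) a 0 f k^-1 0
    gA gB nk uM D0 _ hP hQ) => [|z|z].
  - rewrite mul0r sub0r oppr_eq0 mulf_neq0 ?invr_eq0//.
    by case: hf => ->; rewrite ?oppr_eq0 oner_eq0.
  - have [-> -> ->] := rows3E 1 0 0 (f * c00) (2 * f * c01) (2 * f * c02) 0 l m z.
    have := h (xi2 z) (xi3 z) => hz.
    transitivity (f * (c00 * xi1 z ^+ 2 + 2 * c01 * xi1 z * xi2 z + 2 * c02 * xi1 z * xi3 z)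
       + f * f * (l * xi2 z + m * xi3 z) ^+ 2); first by rewrite f2; ring.
    by rewrite -[X in _ + X]mulrA -hz; ring.
  - have [-> _ _] := rows3E 1 0 0 (f * c00) (2 * f * c01) (2 * f * c02) 0 l m z.
    by field.
(* the translation (s, t) solves the linear system that cancels the terms
   xi1 xi2 and xi1 xi3 *)
pose s := (c01 * c22 - c02 * c12) / (c11 * c22 - c12 ^+ 2).
pose t := (c02 * c11 - c01 * c12) / (c11 * c22 - c12 ^+ 2).
have [f [f' [l [m [l' [m' [hf hf' h]]]]]]] := binary_diagonal c11 c12 c22.
pose q := c00 - (c11 * s ^+ 2 + 2 * c12 * s * t + c22 * t ^+ 2).
have hQ2 z : c00 * xi1 z ^+ 2 + c11 * xi2 z ^+ 2 + c22 * xi3 z ^+ 2 +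
  2 * (c01 * xi1 z * xi2 z + c02 * xi1 z * xi3 z + c12 * xi2 z * xi3 z) =
  f * ((l * s + m * t) * xi1 z + l * xi2 z + m * xi3 z) ^+ 2 +
  f' * ((l' * s + m' * t) * xi1 z + l' * xi2 z + m' * xi3 z) ^+ 2 + q * xi1 z ^+ 2.
  have := h (xi2 z + s * xi1 z) (xi3 z + t * xi1 z).
  rewrite (_ : l * _ + m * _ = (l * s + m * t) * xi1 z + l * xi2 z + m * xi3 z); last by ring.
  rewrite (_ : l' * _ + m' * _ = (l' * s + m' * t) * xi1 z + l' * xi2 z + m' * xi3 z); last by ring.
  by move=> <-; rewrite /q /s /t; field.
have build (g : R) P' N : (g = 1 \/ g = -1) ->
    (forall z, P' (N *m z) = - (g * q / k) * (k * xi1 z ^+ 2) +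
      g * (c00 * xi1 z ^+ 2 + c11 * xi2 z ^+ 2 + c22 * xi3 z ^+ 2 +
  2 * (c01 * xi1 z * xi2 z + c02 * xi1 z * xi3 z + c12 * xi2 z * xi3 z))) ->
    (forall z, xi3 (N *m z) = xi1 z) -> equivalent_pair P Q P' (fun x => xi3 x ^+ 2).
  move=> hg hP' h3; apply: (@equivalent_of_forms_comp A B P Q _ _ _ _ M N a b (- b) a
    (- (g * q / k)) g k^-1 0 gA gB nk uM D0 _ hP hQ hP') => [|z].
    rewrite mulr0 sub0r oppr_eq0 mulf_neq0 ?invr_eq0//.
    by case: hg => ->; rewrite ?oppr_eq0 oner_eq0.
  by rewrite h3; field.
pose N1 := rows3 (l * s + m * t) l m (l' * s + m' * t) l' m' 1 0 0.
pose N2 := rows3 (l' * s + m' * t) l' m' (l * s + m * t) l m 1 0 0.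
have N13 z : xi3 (N1 *m z) = xi1 z.
  by have [_ _ ->] := rows3E (l * s + m * t) l m (l' * s + m' * t) l' m' 1 0 0 z; ring.
have N23 z : xi3 (N2 *m z) = xi1 z.
  by have [_ _ ->] := rows3E (l' * s + m' * t) l' m' (l * s + m * t) l m 1 0 0 z; ring.
have one : (1 : R) = 1 \/ (1 : R) = -1 by left.
have mone : (-1 : R) = 1 \/ (-1 : R) = -1 by right.
case: hf hf' => fE [] fE'.
- apply: Or31; apply: (build 1 _ N1 one _ N13) => z.
  rewrite hQ2 fE fE'; have [-> -> _] := rows3E (l * s + m * t) l m (l' * s + m' * t) l' m' 1 0 0 z.
  by field.
- apply: Or32; apply: (build 1 _ N1 one _ N13) => z.
  rewrite hQ2 fE fE'; have [-> -> _] := rows3E (l * s + m * t) l m (l' * s + m' * t) l' m' 1 0 0 z.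
  by field.
- apply: Or32; apply: (build 1 _ N2 one _ N23) => z.
  rewrite hQ2 fE fE'; have [-> -> _] := rows3E (l' * s + m' * t) l' m' (l * s + m * t) l m 1 0 0 z.
  by field.
- apply: Or31; apply: (build (-1) _ N1 mone _ N13) => z.
  rewrite hQ2 fE fE'; have [-> -> _] := rows3E (l * s + m * t) l m (l' * s + m' * t) l' m' 1 0 0 z.
  by field.
Qed.

(** On the plane xi1 = 0 the forms are k and k' times the square of y xi2 + z0 xi3.
    So k' P - k Q is xi1 times a linear form L, and k P + k' Q is the square of
    W = m xi2 + n xi3 plus xi1 times a linear form.  L is not proportional to xi1
    since no member has rank one.  If W depends on xi1 and L, replacing it by a
    multiple of L leads to the first normal form.  Otherwise xi1, L, W are
    coordinates, and completing the square in W leaves a multiple of xi1^2,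
    nonzero again because no member has rank one; its sign selects the second or
    the third. *)
Lemma normal_form_flat M : M \in unitmx -> ~ rank1_member A B ->
  (forall a b : R, lower_det (M^T *m (a *: A + b *: B) *m M) = 0) ->
  (exists a b : R, ~ lower_zero (M^T *m (a *: A + b *: B) *m M)) ->
  [\/ equivalent_pair P Q (fun x => xi1 x * xi2 x) (fun x => xi1 x * xi3 x + xi2 x ^+ 2),
      equivalent_pair P Q (fun x => xi1 x * xi2 x) (fun x => xi1 x ^+ 2 + xi3 x ^+ 2) |
      equivalent_pair P Q (fun x => xi1 x * xi2 x) (fun x => xi1 x ^+ 2 - xi3 x ^+ 2)].
Proof.
move=> uM nr ld nz.
have gA' := gram_change M gA; have gB' := gram_change M gB.
have [k [k' [y [z0 [ea eb]]]]] := lower_common_square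
  (fun s t => etrans (congr1 _ (esym (comb_change A B M s t))) (ld s t)).
case: nz => [al [be]]; rewrite comb_change.
move: (M^T *m A *m M) (M^T *m B *m M) gA' gB' ea eb => A' B' gA' gB' [a11 a12 a22] [b11 b12 b22] nz.
have kk : k ^+ 2 + k' ^+ 2 != 0.
  apply/negP; rewrite paddr_eq0 ?sqr_ge0// !sqrf_eq0 => /andP[/eqP k0 /eqP k0'].
  by apply: nz; split; rewrite !comb_entry ?a11 ?a12 ?a22 ?b11 ?b12 ?b22 k0 k0'; ring.
pose r := Num.sqrt (k ^+ 2 + k' ^+ 2).
have r2 : r ^+ 2 = k ^+ 2 + k' ^+ 2 by rewrite sqr_sqrtr// addr_ge0// sqr_ge0.
have r0 : r != 0 by rewrite -sqrf_eq0 r2.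
pose m := r * y; pose n := r * z0.
have mn : m != 0 \/ n != 0.
  have [y0|y0] := eqVneq y 0; last by left; rewrite mulf_neq0.
  right; rewrite mulf_neq0//; apply/eqP => z00; apply: nz.
  by split; rewrite !comb_entry ?a11 ?a12 ?a22 ?b11 ?b12 ?b22 ?y0 ?z00; ring.
have D0 : k' * k' - (- k) * k != 0 by rewrite mulNr opprK -!expr2 addrC.
pose p0 := k' * A' 0 0 - k * B' 0 0.
pose p1 := k' * A' 0 1 - k * B' 0 1; pose p2 := k' * A' 0 2 - k * B' 0 2.
pose d := k * A' 0 0 + k' * B' 0 0.
pose e := k * A' 0 1 + k' * B' 0 1; pose f := k * A' 0 2 + k' * B' 0 2.
pose P2 z := xi1 z * (p0 * xi1 z + 2 * p1 * xi2 z + 2 * p2 * xi3 z).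
pose Q2 z := (m * xi2 z + n * xi3 z) ^+ 2 + xi1 z * (d * xi1 z + 2 * e * xi2 z + 2 * f * xi3 z).
have hP z : k' * P (M *m z) + (- k) * Q (M *m z) = P2 z.
  rewrite (gram_coords z gA') (gram_coords z gB') a11 a12 a22 b11 b12 b22 /P2 /p0 /p1 /p2.
  by ring.
have hQ z : k * P (M *m z) + k' * Q (M *m z) = Q2 z.
  rewrite (gram_coords z gA') (gram_coords z gB') a11 a12 a22 b11 b12 b22 /Q2 /d /e /f /m /n.
  transitivity ((k ^+ 2 + k' ^+ 2) * (y * xi2 z + z0 * xi3 z) ^+ 2 +
   xi1 z * ((k * A' 0 0 + k' * B' 0 0) * xi1 z + 2 * (k * A' 0 1 + k' * B' 0 1) * xi2 z +
   2 * (k * A' 0 2 + k' * B' 0 2) * xi3 z)); first by ring.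
  by rewrite -r2; ring.
have sq (al' be' u0 u1 u2 kap : R) : al' != 0 \/ be' != 0 ->
    ~ (forall z, al' * P2 z + be' * Q2 z = kap * (u0 * xi1 z + u1 * xi2 z + u2 * xi3 z) ^+ 2).
  move=> ab h; apply: nr.
  apply: (@rank1_of_square A B P Q M (al' * k' + be' * k) (- al' * k + be' * k') kap u0 u1 u2) => //.
    have [x0|] := eqVneq (al' * k' + be' * k) 0; last by left.
    right; apply/eqP => x1.
    have h1 : (k ^+ 2 + k' ^+ 2) * al' = 0.
      transitivity (k' * (al' * k' + be' * k) - k * (- al' * k + be' * k')); first by ring.
      by rewrite x0 x1; ring.
    have h2 : (k ^+ 2 + k' ^+ 2) * be' = 0.
      transitivity (k * (al' * k' + be' * k) + k' * (- al' * k + be' * k')); first by ring.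
      by rewrite x0 x1; ring.
    move: h1 h2 => /eqP + /eqP; rewrite !mulf_eq0 (negPf kk) /= => /eqP a0 /eqP b0.
    by case: ab; rewrite ?a0 ?b0 eqxx.
  by move=> z; rewrite -h -hP -hQ; ring.
have [Dl|Dl] := eqVneq (p1 * n - p2 * m) 0.
  have p12 : p1 != 0 \/ p2 != 0.
    have [p10|] := eqVneq p1 0; last by left.
    right; apply/eqP => p20; apply: (sq 1 0 1 0 0 p0); first by left; rewrite oner_eq0.
    by move=> z; rewrite /P2 p10 p20; ring.
  have [mu [mE nE]] : exists mu, m = 2 * mu * p1 /\ n = 2 * mu * p2.
    case: p12 => p0'.
      exists (m / (2 * p1)); split; first by field.
      rewrite (_ : n = p1 * n / p1); last by field.
      by rewrite (_ : p1 * n = p2 * m); [field|lra].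
    exists (n / (2 * p2)); split; last by field.
    rewrite (_ : m = p2 * m / p2); last by field.
    by rewrite (_ : p2 * m = p1 * n); [field|lra].
  have mu0 : mu != 0.
    by apply/eqP => mu0; case: mn; rewrite ?mE ?nE mu0 mulr0 mul0r eqxx.
  apply: Or31; apply: (@equivalent_of_forms_comp A B P Q P2 Q2 _ _ M
    (rows3 1 0 0 (mu * p0) (2 * mu * p1) (2 * mu * p2)
      (d - mu ^+ 2 * p0 ^+ 2) (2 * e - 4 * mu ^+ 2 * p0 * p1) (2 * f - 4 * mu ^+ 2 * p0 * p2))
    k' (- k) k k' mu 0 0 1 gA gB nk uM D0 _ hP hQ) => [|z|z].
  - by rewrite mulr1 mul0r subr0.
  - have [-> -> _] := rows3E 1 0 0 (mu * p0) (2 * mu * p1) (2 * mu * p2)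
      (d - mu ^+ 2 * p0 ^+ 2) (2 * e - 4 * mu ^+ 2 * p0 * p1) (2 * f - 4 * mu ^+ 2 * p0 * p2) z.
    by rewrite /P2; ring.
  - have [-> -> ->] := rows3E 1 0 0 (mu * p0) (2 * mu * p1) (2 * mu * p2)
      (d - mu ^+ 2 * p0 ^+ 2) (2 * e - 4 * mu ^+ 2 * p0 * p1) (2 * f - 4 * mu ^+ 2 * p0 * p2) z.
    by rewrite /Q2 mE nE; ring.
(* by Cramer's rule, 2 e xi2 + 2 f xi3 = e' (2 p1 xi2 + 2 p2 xi3) + f' W *)
pose e' := (e * n - f * m) / (p1 * n - p2 * m).
pose f' := 2 * (p1 * f - p2 * e) / (p1 * n - p2 * m).
pose del := d - e' * p0 - f' ^+ 2 / 4.
have key z : Q2 z - e' * P2 z = (f' / 2 * xi1 z + m * xi2 z + n * xi3 z) ^+ 2 + del * xi1 z ^+ 2.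
  by rewrite /Q2 /P2 /del /e' /f'; field.
have del0 : del != 0.
  apply/eqP => del0; apply: (sq (- e') 1 (f' / 2) m n 1); first by right; rewrite oner_eq0.
  by move=> z; move: (key z); rewrite del0 => h; lra.
have [g [s [hg dE]]] := signed_square del.
have s0 : s != 0 by apply: contraNneq del0 => s0; rewrite dE s0 expr0n mulr0.
pose N := rows3 s 0 0 p0 (2 * p1) (2 * p2) (f' / 2) m n.
have NE z := rows3E s 0 0 p0 (2 * p1) (2 * p2) (f' / 2) m n z.
have build Q' : (forall z, Q' (N *m z) = - (g * e') * P2 z + g * Q2 z) ->
    equivalent_pair P Q (fun x => xi1 x * xi2 x) Q'.
  move=> hQ'; apply: (@equivalent_of_forms_comp A B P Q P2 Q2 _ _ M N k' (- k) k k' s 0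
    (- (g * e')) g gA gB nk uM D0 _ hP hQ _ hQ') => [|z].
    rewrite mul0r subr0 mulf_neq0//.
    by case: hg => ->; rewrite ?oppr_eq0 oner_eq0.
  by have [-> -> _] := NE z; rewrite /P2; ring.
have QE z : - (g * e') * P2 z + g * Q2 z = g * (Q2 z - e' * P2 z) by ring.
case: hg => gE; [apply: Or32|apply: Or33]; apply: build => z;
  by rewrite QE key dE gE; have [-> _ ->] := NE z; ring.
Qed.

(** Both forms vanish on xi1 = 0, so both are divisible by xi1. *)
Lemma normal_form_zero M : M \in unitmx ->
  (forall a b : R, lower_zero (M^T *m (a *: A + b *: B) *m M)) ->
  equivalent_pair P Q (fun x => xi1 x * xi2 x) (fun x => xi1 x * xi3 x).
Proof.
move=> uM lz; have gA' := gram_change M gA; have gB' := gram_change M gB.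
have [a11 a12 a22] := lz 1 0; have [b11 b12 b22] := lz 0 1.
move: a11 a12 a22 b11 b12 b22; rewrite !scale1r !scale0r addr0 add0r.
move: (M^T *m A *m M) (M^T *m B *m M) gA' gB' => A' B' gA' gB' a11 a12 a22 b11 b12 b22.
apply: (@equivalent_of_forms R A B P Q _ _ M (rows3 1 0 0 (A' 0 0) (2 * A' 0 1) (2 * A' 0 2)
  (B' 0 0) (2 * B' 0 1) (2 * B' 0 2)) 1 0 0 1 gA gB nk uM) => [|z|z].
- by rewrite mulr1 mul0r subr0 oner_eq0.
- have [-> -> _] := rows3E 1 0 0 (A' 0 0) (2 * A' 0 1) (2 * A' 0 2)
    (B' 0 0) (2 * B' 0 1) (2 * B' 0 2) z.
  by rewrite (gram_coords z gA') a11 a12 a22; ring.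
- have [-> _ ->] := rows3E 1 0 0 (A' 0 0) (2 * A' 0 1) (2 * A' 0 2)
    (B' 0 0) (2 * B' 0 1) (2 * B' 0 2) z.
  by rewrite (gram_coords z gB') b11 b12 b22; ring.
Qed.

Lemma condCM_pencil : condCM P Q <-> ~ has_square_factor (pencil_det A B).
Proof.
pose c s t := \det (s *: hessian P 0 + t *: hessian Q 0).
have cE s t : c s t = 8 * pencil_det A B s t.
  rewrite /c (hessian_gram _ gA) (hessian_gram _ gB) /pencil_det.
  by rewrite !det_mx3 !comb_entry !mxE; ring.
have bc : binary_cubic c.
  have [c0 [c1 [c2 [c3 h]]]] := pencil_det_cubic A B.
  by exists (8 * c0), (8 * c1), (8 * c2), (8 * c3) => s t; rewrite cE h; ring.
have := negpow_integrals_finite_iff bc; rewrite /condCM => -> ; split => h sq; apply: h.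
  exact: has_square_factor_scale cE sq.
apply: (@has_square_factor_scale R 8^-1 _ c) sq => s t.
by rewrite cE; field.
Qed.

End Pair.
End NormalForms.

(** * The classification *)

Theorem theorem1p2 (R : realType) (P Q : 'cV[R]_3 -> R)
  (hP : quadratic_form P) (hQ : quadratic_form Q)
  (hirr : irreducible_pair P Q) :
  [/\ (condCM P Q <-> condD P Q /\ condR 2 P Q),
      (~ condD P Q ->
         [\/ equivalent_pair P Q (fun x => xi1 x ^+ 2 + xi2 x ^+ 2)
                                 (fun x => xi3 x ^+ 2),
             equivalent_pair P Q (fun x => xi1 x ^+ 2 - xi2 x ^+ 2)
                                 (fun x => xi3 x ^+ 2) |
             equivalent_pair P Q (fun x => xi1 x * xi2 x + xi3 x ^+ 2)
                                 (fun x => xi1 x ^+ 2)]),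
      (condD P Q -> condR 1 P Q ->
         [\/ equivalent_pair P Q (fun x => xi1 x * xi2 x)
                                 (fun x => xi1 x * xi3 x + xi2 x ^+ 2),
             equivalent_pair P Q (fun x => xi1 x * xi2 x)
                                 (fun x => xi1 x ^+ 2 + xi3 x ^+ 2) |
             equivalent_pair P Q (fun x => xi1 x * xi2 x)
                                 (fun x => xi1 x ^+ 2 - xi3 x ^+ 2)]) &
      (condD P Q -> condR 0 P Q ->
         equivalent_pair P Q (fun x => xi1 x * xi2 x)
                             (fun x => xi1 x * xi3 x))].
Proof.
have [A gA] := quadratic_form_gram hP; have [B gB] := quadratic_form_gram hQ.
have [sA _] := gA; have [sB _] := gB.
have nk := irreducible_kernel gA gB hirr.
have indep := irreducible_indep gA gB hirr.
have DN : condD P Q <-> ~ rank1_member A B.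
  split=> [D r1|nr]; first exact: rank1_not_condD gA gB r1 D.
  by apply: contrapT => nD; apply: nr; exact: not_condD_rank1 gA gB nk nD.
split.
- rewrite (condCM_pencil gA gB) DN (condR2P gA gB); split=> [nsq|[nr nf] sq].
    split=> h; apply: nsq; [exact: rank1_square_factor|exact: flat_square_factor].
  by have [] := square_factor_degenerate sA sB nk sq.
- move=> nD; apply: (normal_form_rank1 gA gB nk indep).
  exact: not_condD_rank1 gA gB nk nD.
- move=> /DN nr /(condR1_flat gA gB)[M uM [ld nz]].
  exact: (normal_form_flat gA gB nk uM nr ld nz).
- by move=> _ /(condR0_flat gA gB)[M uM lz]; exact: (normal_form_zero gA gB nk uM lz).
Qed.
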